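(* Let $n\ge 12$ be an even integer and let $g,h,f\in\mathrm{Tame}(\mathbf{k}^3)$ be defined by $g^{-1}(x_1,x_2,x_3)=(x_2,\,x_1+x_2x_3,\,x_3)$, $h^{-1}(x_1,x_2,x_3)=(x_3,x_1,x_2)$ and $f=g^n\circ h$. Then, for the action of $G=\mathrm{Tame}(\mathbf{k}^3)$ on $\mathcal{C}^1$, the element $f$ is weakly properly discontinuous (WPD).
   Context: Let $\mathbf{k}$ be a field of characteristic zero. Let $A_3=\mathrm{GL}_3(\mathbf{k})\ltimes\mathbf{k}^3$ be the group of affine automorphisms of $\mathbf{k}^3$ and $E_3=\{(x_1+P(x_2,x_3),x_2,x_3): P\in\mathbf{k}[x_2,x_3]\}$. The tame automorphism group is $\mathrm{Tame}(\mathbf{k}^3)=\langle A_3,E_3\rangle\subset\mathrm{Aut}(\mathbf{k}^3)$. For $r\in\{1,2,3\}$, an $r$-tuple of components is a polynomial map $(f_1,\dots,f_r)\colon\mathbf{k}^3\to\mathbf{k}^r$ which is the list of the first $r$ components of some $(f_1,f_2,f_3)\in\mathrm{Tame}(\mathbf{k}^3)$. A vertex of type $r$ is an orbit $[f_1,\dots,f_r]=\{a\circ(f_1,\dots,f_r): a\in A_r\}$, where $A_r=\mathrm{GL}_r(\mathbf{k})\ltimes\mathbf{k}^r$ acts by post-composition. The complex $\mathcal{C}$ is the 2-dimensional simplicial complex whose vertices are all vertices of types 1, 2, 3, and whose simplices are, for every $(f_1,f_2,f_3)\in\mathrm{Tame}(\mathbf{k}^3)$, the triangle spanned by $[f_1],[f_1,f_2],[f_1,f_2,f_3]$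 together with its faces. $\mathrm{Tame}(\mathbf{k}^3)$ acts on $\mathcal{C}$ by $g\cdot[f_1,\dots,f_r]=[f_1\circ g^{-1},\dots,f_r\circ g^{-1}]$. $\mathcal{C}^1$ is the 1-skeleton of $\mathcal{C}$ with the path metric where each edge has length $1$. If a group $G$ acts by isometries on a metric space $X$, an element $f\in G$ is WPD if for some (equivalently any) $x\in X$ and every $C\ge1$ there is $K$ such that for all $k\ge K$ there are only finitely many $j\in G$ with $d(x,j\cdot x)\le C$ and $d(f^k\cdot x,\,j\circ f^k\cdot x)\le C$. *)

(* Defs.v *)
(* Polynomials in k[x1,x2,x3] are nested univariate
   polynomials {poly {poly {poly k}}}: innermost variable x1, middle x2,
   outermost x3. *)
From HB Require Import structures.
From mathcomp Require Import all_boot all_order all_algebra.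
Set Implicit Arguments. Unset Strict Implicit. Unset Printing Implicit Defensive.
Import Order.TTheory GRing.Theory Num.Theory.
Local Open Scope ring_scope.

Section Tame.
Variable k : fieldType.

Definition R3 := {poly {poly {poly k}}}.
Definition cst (c : k) : R3 := c%:P%:P%:P.
Definition X1 : R3 := ('X : {poly k})%:P%:P.
Definition X2 : R3 := ('X : {poly {poly k}})%:P.
Definition X3 : R3 := 'X.

Definition Map := (R3 * R3 * R3)%type.
Definition comps (F : Map) : seq R3 := [:: F.1.1; F.1.2; F.2].

Definition ev (B : Map) (P : R3) : R3 :=
  (map_poly (fun q : {poly {poly k}} =>
     (map_poly (fun r : {poly k} => (map_poly cst r).[B.1.1]) q).[B.1.2]) P).[B.2].

Definition mcomp (A B : Map) : Map := (ev B A.1.1, ev B A.1.2, ev B A.2).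
Definition id3 : Map := (X1, X2, X3).
Definition mpow (F : Map) (m : nat) : Map := iter m (mcomp F) id3.

Definition affmap (M : 'M[k]_3) (c : 'I_3 -> k) : Map :=
  let X := [:: X1; X2; X3] in
  let compo_i (i : 'I_3) := \sum_(j < 3) cst (M i j) * nth 0 X j + cst (c i) in
  (compo_i 0, compo_i 1, compo_i 2).

(* elementary map (x1 + P(x2,x3), x2, x3), P in k[x2,x3]
   (inner variable of P is x2, outer is x3) *)
Definition embed23 (P : {poly {poly k}}) : R3 :=
  map_poly (map_poly (fun c : k => c%:P)) P.
Definition elem (P : {poly {poly k}}) : Map := (X1 + embed23 P, X2, X3).

(* Tame(k^3) = <A_3, E_3>; both generating sets are closed under inverses *)
Inductive tame : Map -> Prop :=
| tame_id : tame id3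
| tame_aff (M : 'M[k]_3) c F : M \in unitmx -> tame F -> tame (mcomp (affmap M c) F)
| tame_el P F : tame F -> tame (mcomp (elem P) F).

Definition inv_pair (j j' : Map) : Prop := mcomp j j' = id3 /\ mcomp j' j = id3.

Definition is_vertex (u : seq R3) : Prop :=
  (1 <= size u <= 3)%N /\ exists F, tame F /\ u = take (size u) (comps F).

Definition aff_eq (u v : seq R3) : Prop :=
  size v = size u /\
  exists (M : 'M[k]_(size u)) (c : 'I_(size u) -> k), M \in unitmx /\
    forall i : 'I_(size u),
      nth 0 v i = \sum_(j < size u) cst (M i j) * nth 0 u j + cst (c i).

(* edges of C: two distinct vertices of a triangle [f1],[f1,f2],[f1,f2,f3] *)
Definition adj (u v : seq R3) : Prop :=
  exists F, tame F /\ exists i j : nat,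
    [&& 1 <= i <= 3, 1 <= j <= 3 & i != j]%N /\
    aff_eq (take i (comps F)) u /\ aff_eq (take j (comps F)) v.

Definition dle (C : nat) (u v : seq R3) : Prop :=
  exists (m : nat) (w : nat -> seq R3), (m <= C)%N /\ w 0%N = u /\
    aff_eq (w m) v /\ forall i, (i < m)%N -> adj (w i) (w i.+1).

(* action: g . [u] = [u o g^{-1}]; here ginv is g^{-1} *)
Definition act_by_inv (ginv : Map) (u : seq R3) : seq R3 := [seq ev ginv p | p <- u].

(* f (given through its inverse tfinv) is WPD for the action of Tame(k^3) on C^1:
   j ranges over Tame(k^3), j' is its inverse; f^k = (tfinv^k)^{-1} and
   (j o f^k)^{-1} = tfinv^k o j'. *)
Definition WPD (tfinv : Map) : Prop :=
  exists x, is_vertex x /\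
  forall C : nat, (1 <= C)%N -> exists K : nat, forall kk : nat, (K <= kk)%N ->
    exists l : seq Map, forall j j' : Map,
      tame j -> inv_pair j j' ->
      dle C x (act_by_inv j' x) ->
      dle C (act_by_inv (mpow tfinv kk) x) (act_by_inv (mcomp (mpow tfinv kk) j') x) ->
      j \in l.

(* g^{-1} and h^{-1} from the statement; f = g^n o h, so f^{-1} = h^{-1} o (g^{-1})^n *)
Definition ginv : Map := (X2, X1 + X2 * X3, X3).
Definition hinv : Map := (X3, X1, X2).
Definition tfinv (n : nat) : Map := mcomp hinv (mpow ginv n).

End Tame.

(* Main.v *)
(** Adjacent vertices yield components p, q of one automorphism, hence a nonzero locally
    nilpotent derivation killing both.  For every weight its leading part kills the leading
    forms of p and q, and the kernel of that part is factorially closed; so x3 - x1 x2 cannot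
    divide the leading form of p while x3 divides that of q, and likewise for x2 - x1 x3
    and x2.

    Put p_l = x3 o f^-l o j^-1 and let s(l) count the steps i after which the leading form of
    p_l o f^i, for weights adapted to f, still avoids the divisor x2 - x1 x3.  The obstruction
    above gives s(l+1) <= s(l) + 1.  If j moves both ends of a long orbit segment by at most C,
    then s(0) is bounded and s(k) is at least k minus a constant, so s has five consecutive
    unit steps; these force p_(l+t) o f^(i+t) into k[x3] for four consecutive t.  Comparing
    continuants shows that f^-(l+2) o j^-1 o f^(i+2) is then diagonal with entries +-1, which
    leaves finitely many j. *)
Require Import Defs.
From HB Require Import structures.
From mathcomp Require Import all_boot all_order all_algebra.
From mathcomp Require Import perm zify ring.
Set Implicit Arguments. Unset Strict Implicit. Unset Printing Implicit Defensive.
Import Order.TTheory GRing.Theory Num.Theory.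
Local Open Scope ring_scope.
Local Notation inv_pair := Defs.inv_pair.

(** The obstacle is cancellation of leading forms. For weights with w1 < w2 + w3 the leading part of
    g^-1 is (x2, x2 x3, x3), which is not invertible: its image is the surface x2 = x1 x3. Leading
    forms therefore commute with composition by g until the divisor x2 - x1 x3 appears; h turns this
    divisor into x3 - x1 x2. A leading form that has survived lies in the image of the degenerate
    map, so it is free of x1 and tends to be divisible by x2 or x3: this is the origin of those two
    factors in the obstruction. The weights are (N, N+1, 1), restarted after every f, with N chosen
    after j and so large that they order all monomials in sight lexicographically. Passing between
    p_l and p_(l+1) costs only one of the n factors g, so two such passages fit into a single f; the
    exception is a polynomial in k[x3], which has no monomial heavier than the powers of x3. This is
    why consecutive unit steps produce members of k[x3]. Rigidity needs three consecutive ones and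
    leaves a scalar free; a fourth identifies that scalar with a sign. *)

(* The polynomial ring k[x1,x2,x3] given by its universal property and its
   coefficients.  Reasoning from this interface keeps the unifier away from the
   three nested layers of polynomials in R3. *)
Record pol3 (k : fieldType) := Pol3 {
  pol :> idomainType;
  pcst : {rmorphism k -> pol};
  px1 : pol;
  px2 : pol;
  px3 : pol;
  ev_in : forall A : comNzRingType, {rmorphism k -> A} -> A -> A -> A -> {rmorphism pol -> A};
  ev_in_cst : forall A f a b c x, @ev_in A f a b c (pcst x) = f x;
  ev_in_X1 : forall A f a b c, @ev_in A f a b c px1 = a;
  ev_in_X2 : forall A f a b c, @ev_in A f a b c px2 = b;
  ev_in_X3 : forall A f a b c, @ev_in A f a b c px3 = c;
  mon_ind : forall K : pol -> Prop, K 0 -> (forall P Q, K P -> K Q -> K (P + Q)) ->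
    (forall x a b c, K (pcst x * px1 ^+ a * px2 ^+ b * px3 ^+ c)) -> forall P, K P;
  cf : pol -> nat -> nat -> nat -> k;
  cfD : forall P Q a b c, cf (P + Q) a b c = cf P a b c + cf Q a b c;
  cf_neq0 : forall P, P != 0 -> exists a b c, cf P a b c != 0;
  cf_mon : forall x a b c a' b' c',
    cf (pcst x * px1 ^+ a * px2 ^+ b * px3 ^+ c) a' b' c' =
    if [&& a' == a, b' == b & c' == c] then x else 0
}.

(** * Nested univariate polynomials as a model of the interface *)

Section Model.
Variable k : fieldType.
Definition R3_ring : idomainType := {poly {poly {poly k}}}.
Definition R3_cst : {rmorphism k -> R3_ring} :=
  (polyC : {rmorphism {poly {poly k}} -> {poly {poly {poly k}}}}) \o
  ((polyC : {rmorphism {poly k} -> {poly {poly k}}}) \o (polyC : {rmorphism k -> {poly k}})).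
Local Notation R := R3_ring.
Local Notation x1 := (X1 k : R).
Local Notation x2 := (X2 k : R).
Local Notation x3 := (X3 k : R).
Local Notation cst := R3_cst.

Section EvalIn.
Variables (A : comNzRingType) (f : {rmorphism k -> A}) (a b c : A).

Definition R3_eval1 : {rmorphism {poly k} -> A} :=
  horner_morph (fun x => mulrC a (f x)).
Definition R3_eval2 : {rmorphism {poly {poly k}} -> A} :=
  horner_morph (fun x => mulrC b (R3_eval1 x)).
Definition R3_eval : {rmorphism R -> A} :=
  horner_morph (fun x => mulrC c (R3_eval2 x)).

Lemma R3_eval_cst x : R3_eval (cst x) = f x.
Proof. by rewrite /R3_eval /R3_cst /= horner_morphC /= horner_morphC /= horner_morphC. Qed.
Lemma R3_eval_X1 : R3_eval x1 = a.
Proof. by rewrite /R3_eval /X1 /= horner_morphC /= horner_morphC /= horner_morphX. Qed.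
Lemma R3_eval_X2 : R3_eval x2 = b.
Proof. by rewrite /R3_eval /X2 /= horner_morphC /= horner_morphX. Qed.
Lemma R3_eval_X3 : R3_eval x3 = c.
Proof. by rewrite /R3_eval /= /X3 horner_morphX. Qed.
End EvalIn.

Definition R3_cf (P : R) (a b c : nat) : k := P`_c`_b`_a.

Lemma R3_cfD P Q a b c : R3_cf (P + Q) a b c = R3_cf P a b c + R3_cf Q a b c.
Proof. by rewrite /R3_cf !coefD. Qed.

Lemma R3_cf_neq0 P : P != 0 -> exists a b c, R3_cf P a b c != 0.
Proof.
move=> P0; have := P0; rewrite -lead_coef_eq0 lead_coefE => P1.
have := P1; rewrite -lead_coef_eq0 lead_coefE => P2.
have := P2; rewrite -lead_coef_eq0 lead_coefE => P3.
by do 3!eexists; exact: P3.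
Qed.

Definition R3_mon x a b c : R := cst x * x1 ^+ a * x2 ^+ b * x3 ^+ c.

Lemma R3_cf_mon x a b c a' b' c' :
  R3_cf (R3_mon x a b c) a' b' c' = if [&& a' == a, b' == b & c' == c] then x else 0.
Proof.
rewrite /R3_cf /R3_mon /R3_cst /X1 /X2 /X3 /= -!rmorphXn /= -!rmorphM /= coefCM coefXn.
case: (c' == c); last by rewrite mulr0 !coef0 !andbF.
rewrite mulr1 coefCM coefXn; case: (b' == b); last by rewrite mulr0 !coef0 !andbF.
rewrite mulr1 coefCM coefXn; case: (a' == a); rewrite /= ?mulr0 ?mulr1 //.
Qed.

Lemma R3_mon_ind (K : R -> Prop) :
  K 0 -> (forall P Q, K P -> K Q -> K (P + Q)) ->
  (forall x a b c, K (R3_mon x a b c)) -> forall P, K P.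
Proof.
move=> K0 KD Km P.
have Ksum I r (F : I -> R) : (forall i, K (F i)) -> K (\sum_(i <- r) F i).
  by move=> KF; apply: big_ind.
rewrite -[P]coefK poly_def; apply: (Ksum) => c.
rewrite -[P`_c]coefK poly_def scaler_suml; apply: (Ksum) => b.
rewrite -[P`_c`_b]coefK poly_def.
rewrite !scaler_suml; apply: (Ksum) => a.
have := Km P`_c`_b`_a a b c; rewrite /R3_mon /R3_cst /X1 /X2 /X3 /= -!rmorphXn /=.
by rewrite -!rmorphM /= -!mul_polyC !rmorphM /= !rmorphXn.
Qed.


Definition R3_pol3 : pol3 k :=
  Pol3 R3_eval_cst R3_eval_X1 R3_eval_X2 R3_eval_X3 R3_mon_ind R3_cfD R3_cf_neq0 R3_cf_mon.

End Model.

(** * Polynomial maps acting by substitution *)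

Section Substitution.
Variables (k : fieldType) (M : pol3 k).
Local Notation R := (pol M).
Local Notation x1 := (px1 M).
Local Notation x2 := (px2 M).
Local Notation x3 := (px3 M).
Local Notation cst := (pcst M).

Local Notation PMap := (R * R * R)%type.
Implicit Types (P Q : R) (A B : PMap).

Definition mon x a b c : R := cst x * x1 ^+ a * x2 ^+ b * x3 ^+ c.

Lemma cf0 a b c : cf (0 : R) a b c = 0.
Proof. by apply: (addrI (cf (0 : R) a b c)); rewrite -cfD !addr0. Qed.

Lemma cfP P Q : (forall a b c, cf P a b c = cf Q a b c) -> P = Q.
Proof.
move=> H; apply/eqP; rewrite -subr_eq0; apply/negP => /negP/cf_neq0[a [b [c]]].
apply/negP; rewrite negbK; apply/eqP; apply: (addIr (cf Q a b c)).
by rewrite -cfD subrK add0r.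
Qed.

Lemma Pol_ind (K : R -> Prop) :
  (forall x, K (cst x)) -> K x1 -> K x2 -> K x3 ->
  (forall P Q, K P -> K Q -> K (P + Q)) ->
  (forall P Q, K P -> K Q -> K (P * Q)) -> forall P, K P.
Proof.
move=> Kc K1 K2 K3 KD KM; apply: mon_ind => // [|x a b c].
  by rewrite -(rmorph0 cst).
have KX Q n : K Q -> K (Q ^+ n).
  move=> KQ; elim: n => [|n IH]; first by rewrite expr0 -(rmorph1 cst).
  by rewrite exprS; apply: KM.
by do 3![apply: (KM); last exact: KX].
Qed.

Definition sub (B : PMap) : {rmorphism R -> R} := ev_in M cst B.1.1 B.1.2 B.2.

Lemma sub_cst B x : sub B (cst x) = cst x. Proof. exact: ev_in_cst. Qed.
Lemma sub_X1 B : sub B x1 = B.1.1. Proof. exact: ev_in_X1. Qed.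
Lemma sub_X2 B : sub B x2 = B.1.2. Proof. exact: ev_in_X2. Qed.
Lemma sub_X3 B : sub B x3 = B.2. Proof. exact: ev_in_X3. Qed.
Definition subX := (sub_cst, sub_X1, sub_X2, sub_X3).
Definition pcomp (A B : PMap) : PMap := (sub B A.1.1, sub B A.1.2, sub B A.2).
Definition pid : PMap := (x1, x2, x3).
Definition is_inv (A B : PMap) : Prop := pcomp A B = pid /\ pcomp B A = pid.

Lemma Pol_morph_ext (A : nzRingType) (f g : {rmorphism R -> A}) :
  (forall x, f (cst x) = g (cst x)) -> f x1 = g x1 -> f x2 = g x2 -> f x3 = g x3 ->
  f =1 g.
Proof.
move=> fgc fg1 fg2 fg3; apply: Pol_ind => // P Q HP HQ.
  by rewrite !rmorphD HP HQ.
by rewrite !rmorphM HP HQ.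
Qed.

Lemma sub_comp A B P : sub B (sub A P) = sub (pcomp A B) P :> R.
Proof.
have := @Pol_morph_ext _ (sub B \o sub A) (sub (pcomp A B)).
by apply=> [x|||] /=; rewrite !subX.
Qed.

Lemma sub_id P : sub pid P = P.
Proof.
have := @Pol_morph_ext _ (sub pid) idfun.
by apply=> [x|||] /=; rewrite !subX.
Qed.

Lemma map_eta (A : PMap) : A = (A.1.1, A.1.2, A.2).
Proof. by case: A => -[]. Qed.

Lemma pcompA (A B C : PMap) : pcomp A (pcomp B C) = pcomp (pcomp A B) C.
Proof. by rewrite /pcomp /= !sub_comp. Qed.

Lemma pcomp1 (A : PMap) : pcomp A pid = A.
Proof. by rewrite /pcomp !sub_id -map_eta. Qed.

Lemma pcomp_id (A : PMap) : pcomp pid A = A.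
Proof. by rewrite /pcomp /= !subX -map_eta. Qed.

Lemma is_invC (A B : PMap) : is_inv A B -> is_inv B A.
Proof. by case. Qed.

Lemma is_inv_comp (A A' B B' : PMap) :
  is_inv A A' -> is_inv B B' -> is_inv (pcomp A B) (pcomp B' A').
Proof.
move=> [AA' A'A] [BB' B'B]; split.
  by rewrite pcompA -(pcompA A) BB' pcomp1 AA'.
by rewrite pcompA -(pcompA B') A'A pcomp1 B'B.
Qed.

Lemma sub_inv (A B : PMap) P : is_inv A B -> sub A (sub B P) = P.
Proof. by case=> AB BA; rewrite sub_comp BA sub_id. Qed.

Lemma sub_inj (A B : PMap) : is_inv A B -> injective (sub A).
Proof. by move=> AB; apply: (can_inj (g := sub B)) => P; apply: sub_inv (is_invC AB). Qed.

End Substitution.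

(** * Weighted degrees and leading forms *)

Lemma monomial_shift (A : comNzRingType) (x y1 y2 y3 : A) i j l a b c :
  x%:P * (y1%:P * 'X^i) ^+ a * (y2%:P * 'X^j) ^+ b * (y3%:P * 'X^l) ^+ c =
  (x * y1 ^+ a * y2 ^+ b * y3 ^+ c)%:P * 'X^(i * a + j * b + l * c).
Proof. by rewrite !exprMn -!polyC_exp -!exprM !exprD !polyCM; ring. Qed.

Section Grading.
Variables (k : fieldType) (M : pol3 k).
Local Notation R := (pol M).
Local Notation x1 := (px1 M).
Local Notation x2 := (px2 M).
Local Notation x3 := (px3 M).
Local Notation cst := (pcst M).
Local Notation mon := (mon M).
Implicit Types (w : nat * nat * nat) (P Q : R).

Definition wdot (w : nat * nat * nat) (a b c : nat) : nat := (w.1.1 * a + w.1.2 * b + w.2 * c)%N.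

(* The substitution X_i -> X_i t^(w_i): the coefficient of t^d is the
   homogeneous component of weighted degree d. *)
Definition grade w : {rmorphism R -> {poly R}} :=
  ev_in M (polyC \o cst) (x1%:P * 'X^(w.1.1)) (x2%:P * 'X^(w.1.2)) (x3%:P * 'X^(w.2)).
Definition gcomp w d P : R := (grade w P)`_d.
Definition gdeg w P : nat := (size (grade w P)).-1.
Definition glead w P : R := lead_coef (grade w P).

Lemma gcompE w d P : gcomp w d P = (grade w P)`_d. Proof. by []. Qed.
Lemma gdegE w P : gdeg w P = (size (grade w P)).-1. Proof. by []. Qed.
Lemma gleadE w P : glead w P = gcomp w (gdeg w P) P. Proof. by []. Qed.
Lemma glead_coefE w P : glead w P = lead_coef (grade w P). Proof. by []. Qed.

Lemma grade_cst w x : grade w (cst x) = (cst x)%:P.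
Proof. by rewrite /grade ev_in_cst. Qed.
Lemma grade_X1 w : grade w x1 = x1%:P * 'X^(w.1.1).
Proof. by rewrite /grade ev_in_X1. Qed.
Lemma grade_X2 w : grade w x2 = x2%:P * 'X^(w.1.2).
Proof. by rewrite /grade ev_in_X2. Qed.
Lemma grade_X3 w : grade w x3 = x3%:P * 'X^(w.2).
Proof. by rewrite /grade ev_in_X3. Qed.
Definition gradeX := (grade_cst, grade_X1, grade_X2, grade_X3).

Lemma gcomp0 w d : gcomp w d 0 = 0.
Proof. by rewrite gcompE (rmorph0 (grade w)) coef0. Qed.

Lemma gcompD w d P Q : gcomp w d (P + Q) = gcomp w d P + gcomp w d Q.
Proof. by rewrite !gcompE (rmorphD (grade w)) coefD. Qed.


Lemma grade_mon w x a b c :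
  grade w (mon x a b c) = (mon x a b c)%:P * 'X^(wdot w a b c).
Proof.
rewrite /mon !(rmorphM (grade w)) !(rmorphXn (grade w)) !gradeX.
exact: monomial_shift.
Qed.

Lemma cf_gcomp w d P a b c :
  cf (gcomp w d P) a b c = if wdot w a b c == d then cf P a b c else 0.
Proof.
move: P; apply: mon_ind => [|P Q|x a' b' c'].
- by rewrite gcomp0 cf0 if_same.
- rewrite gcompD !cfD => -> ->.
  by case: ifP => // _; rewrite addr0.
- rewrite !gcompE grade_mon coefCM coefXn cf_mon.
  case: and3P => [[/eqP-> /eqP-> /eqP->]|H].
    rewrite eq_sym; case: (_ == _); first by rewrite mulr1 cf_mon !eqxx.
    by rewrite mulr0 cf0.
  rewrite if_same; case: (_ == _); last by rewrite mulr0 cf0.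
  by rewrite mulr1 cf_mon; case: and3P H.
Qed.

(** Setting t = 1 undoes the grading. Hence [grade] is injective, and leading forms inherit
    multiplicativity from the domain of coefficients. *)
Lemma grade_horner1 w P : (grade w P).[1] = P.
Proof.
have := @Pol_morph_ext _ M _ (horner_eval 1 \o grade w) idfun.
by apply=> [x|||] /=; rewrite gradeX /horner_eval !hornerE ?expr1n ?mulr1.
Qed.

Lemma grade_inj w : injective (grade w).
Proof. by move=> P Q H; rewrite -[P](grade_horner1 w) H grade_horner1. Qed.

Lemma grade_eq0 w P : (grade w P == 0) = (P == 0).
Proof. by rewrite -(rmorph0 (grade w)) (inj_eq (@grade_inj w)). Qed.

Lemma glead_eq0 w P : (glead w P == 0) = (P == 0).
Proof. by rewrite !glead_coefE lead_coef_eq0 grade_eq0. Qed.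

Lemma gleadM w P Q : glead w (P * Q) = glead w P * glead w Q.
Proof. by rewrite !glead_coefE (rmorphM (grade w)) lead_coefM. Qed.

Lemma gdegM w P Q : P != 0 -> Q != 0 -> gdeg w (P * Q) = (gdeg w P + gdeg w Q)%N.
Proof.
move=> P0 Q0; rewrite !gdegE (rmorphM (grade w)) size_mul ?grade_eq0 //.
have: (0 < size (grade w P))%N by rewrite size_poly_gt0 grade_eq0.
have: (0 < size (grade w Q))%N by rewrite size_poly_gt0 grade_eq0.
by move: (size (grade w P)) (size (grade w Q)) => m m'; lia.
Qed.

Lemma size_grade w P : (size (grade w P) <= (gdeg w P).+1)%N.
Proof. rewrite gdegE; exact: leqSpred. Qed.

Lemma size_grade_le w P d :
  (size (grade w P) <= d.+1)%N <-> (gdeg w P <= d)%N.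
Proof. by rewrite !gdegE; case: size => //=. Qed.

Lemma gdegP w P d :
  (gdeg w P <= d)%N <-> forall a b c, cf P a b c != 0 -> (wdot w a b c <= d)%N.
Proof.
split=> [/size_grade_le H a b c Pabc|H].
  rewrite -ltnS; apply: leq_trans H; rewrite ltnNge; apply: contra Pabc => H.
  have := cf_gcomp w (wdot w a b c) P a b c; rewrite eqxx => <-.
  by rewrite !gcompE nth_default // cf0.
apply/size_grade_le/leq_sizeP => e de.
apply: cfP => a b c; rewrite cf0 -[_`_e]/(gcomp w e P) cf_gcomp.
case: eqP => // E; apply/eqP/contraT => /H; rewrite E => /(leq_ltn_trans)/(_ de).
by rewrite ltnn.
Qed.

Lemma cf_glead w P a b c :
  cf (glead w P) a b c = if wdot w a b c == gdeg w P then cf P a b c else 0.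
Proof. by rewrite gleadE cf_gcomp. Qed.

Lemma gcomp_small w P d : (gdeg w P < d)%N -> gcomp w d P = 0.
Proof. by move=> H; rewrite !gcompE nth_default //; apply: leq_trans H; apply: size_grade. Qed.


Lemma gdeg_cst w x : gdeg w (cst x) = 0.
Proof. by rewrite !gdegE grade_cst size_polyC; case: (_ != 0). Qed.

Lemma gdeg0 w : gdeg w 0 = 0.
Proof. by rewrite !gdegE (rmorph0 (grade w)) size_poly0. Qed.

Lemma gdegD_le w P Q d :
  (gdeg w P <= d)%N -> (gdeg w Q <= d)%N -> (gdeg w (P + Q) <= d)%N.
Proof.
move=> /size_grade_le HP /size_grade_le HQ; apply/size_grade_le.
by rewrite (rmorphD (grade w)) (leq_trans (size_polyD _ _)) // geq_max HP.
Qed.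

Lemma gdegM_le w P Q d d' :
  (gdeg w P <= d)%N -> (gdeg w Q <= d')%N -> (gdeg w (P * Q) <= d + d')%N.
Proof.
have [->|P0] := eqVneq P 0; first by rewrite mul0r gdeg0.
have [->|Q0] := eqVneq Q 0; first by rewrite mulr0 gdeg0.
by rewrite gdegM //; apply: leq_add.
Qed.

Lemma gcompM_top w P Q d d' :
  (gdeg w P <= d)%N -> (gdeg w Q <= d')%N ->
  gcomp w (d + d') (P * Q) = gcomp w d P * gcomp w d' Q.
Proof.
move=> Pd Qd; rewrite !gcompE (rmorphM (grade w)) coefM.
rewrite (bigD1 (inord d)) //= inordK ?ltnS ?leq_addr // addKn.
rewrite big1 ?addr0 // => i Hi.
have id : nat_of_ord i != d.
  by apply: contraNneq Hi => E; apply/eqP/val_inj; rewrite /= inordK ?ltnS ?leq_addr.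
have [lt|ge] := ltnP d i.
  rewrite nth_default ?mul0r //; apply: leq_trans lt; exact/size_grade_le.
rewrite [X in _ * X]nth_default ?mulr0 //.
apply: (@leq_trans d'.+1); first exact/size_grade_le.
by move: id ge; lia.
Qed.

Lemma gdeg_mon w x a b c : x != 0 -> gdeg w (mon x a b c) = wdot w a b c.
Proof.
move=> x0; rewrite !gdegE grade_mon size_Cmul ?size_polyXn //.
apply: contraTneq (x0) => H; have := cf_mon M x a b c a b c.
by rewrite -[X in cf X]/(mon x a b c) H cf0 !eqxx /= => <-; rewrite eqxx.
Qed.

Lemma gdeg_X1 w : gdeg w x1 = w.1.1.
Proof.
have := @gdeg_mon w 1 1 0 0 (oner_neq0 _).
by rewrite /mon rmorph1 mul1r expr1 !expr0 !mulr1 /wdot; lia.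
Qed.
Lemma gdeg_X2 w : gdeg w x2 = w.1.2.
Proof.
have := @gdeg_mon w 1 0 1 0 (oner_neq0 _).
by rewrite /mon rmorph1 mul1r expr1 !expr0 !mulr1 mul1r /wdot; lia.
Qed.
Lemma gdeg_X3 w : gdeg w x3 = w.2.
Proof.
have := @gdeg_mon w 1 0 0 1 (oner_neq0 _).
by rewrite /mon rmorph1 mul1r expr1 !expr0 !mul1r /wdot; lia.
Qed.
Lemma gcomp_X1 w : gcomp w w.1.1 x1 = x1.
Proof. by rewrite !gcompE grade_X1 coefCM coefXn eqxx mulr1. Qed.
Lemma gcomp_X2 w : gcomp w w.1.2 x2 = x2.
Proof. by rewrite !gcompE grade_X2 coefCM coefXn eqxx mulr1. Qed.
Lemma gcomp_X3 w : gcomp w w.2 x3 = x3.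
Proof. by rewrite !gcompE grade_X3 coefCM coefXn eqxx mulr1. Qed.
Lemma gcomp_cst w x : gcomp w 0 (cst x) = cst x.
Proof. by rewrite !gcompE grade_cst coefC. Qed.
Definition gcompX := (gcomp_cst, gcomp_X1, gcomp_X2, gcomp_X3).

Lemma glead_X1 w : glead w x1 = x1.
Proof. by rewrite gleadE gdeg_X1 gcomp_X1. Qed.
Lemma glead_X3 w : glead w x3 = x3.
Proof. by rewrite gleadE gdeg_X3 gcomp_X3. Qed.

Lemma sum_gcomp w d P : (gdeg w P <= d)%N -> P = \sum_(e < d.+1) gcomp w e P.
Proof.
move=> /size_grade_le H; rewrite -{1}[P](grade_horner1 w) (horner_coef_wide _ H).
by apply: eq_bigr => i _; rewrite expr1n mulr1.
Qed.

(* [K P d C] is meant to be proved for C the component of degree d of P, which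
   vanishes once the bound d on the degree of P is not sharp. *)
Lemma graded_ind w (K : R -> nat -> R -> Prop) :
  (forall x, K (cst x) 0 (cst x)) ->
  K x1 w.1.1 x1 -> K x2 w.1.2 x2 -> K x3 w.2 x3 ->
  (forall P d C, K P d C -> K P d.+1 0) ->
  (forall P Q d C D, K P d C -> K Q d D -> K (P + Q) d (C + D)) ->
  (forall P Q d e C D, K P d C -> K Q e D -> K (P * Q) (d + e)%N (C * D)) ->
  forall P d, (gdeg w P <= d)%N -> K P d (gcomp w d P).
Proof.
move=> Kc K1 K2 K3 Kw KD KM P d Pd; rewrite {1}(sum_gcomp Pd) => {Pd}.
have K0 e : K 0 e 0.
  by elim: e => [|e IH]; [have := Kc 0; rewrite rmorph0 | apply: Kw IH].
have KX Q q n : K Q q Q -> K (Q ^+ n) (q * n)%N (Q ^+ n).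
  move=> KQ; elim: n => [|n IH].
    by rewrite muln0 !expr0; have := Kc 1; rewrite rmorph1.
  by rewrite mulnS !exprS; apply: KM.
have Kmon x a b c : K (mon x a b c) (wdot w a b c) (mon x a b c).
  rewrite /wdot /mon; apply: (KM); last exact: KX.
  by apply: (KM); [rewrite -[(_ * a)%N]add0n; apply: KM => //|]; apply: KX.
have Kwk Q q C e : K Q q C -> (q < e)%N -> K Q e 0.
  by move=> KQ; elim: e => // e IH; rewrite ltnS leq_eqVlt => /orP[/eqP<-|/IH /Kw //]; apply: Kw KQ.
move: P; apply: mon_ind => [|P Q IHP IHQ|x a b c].
- rewrite big1 => [|i _]; last by rewrite gcomp0.
  by rewrite gcomp0.
- rewrite gcompD; under eq_bigr do rewrite gcompD.
  by rewrite big_split; apply: KD.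
have E e : gcomp w e (mon x a b c) = if e == wdot w a b c then mon x a b c else 0.
  by rewrite !gcompE grade_mon coefCM coefXn; case: eqP; rewrite ?mulr1 ?mulr0.
rewrite E; under eq_bigr do rewrite E.
(* A monomial above degree [d] drops out of the truncated sum, one below enters through the
   weakening clause, and one of degree [d] is its own component. *)
rewrite -big_mkcond /=; case: (ltngtP d (wdot w a b c)) => H.
- by rewrite big1 // => i /eqP; have := ltn_ord i; lia.
- rewrite (big_pred1 (inord (wdot w a b c))); first exact: Kwk H.
  by move=> i /=; rewrite -[RHS]val_eqE /= inordK // ltnS ltnW.
- rewrite -H (big_pred1 ord_max); first by rewrite H; apply: Kmon.
  by move=> i.
Qed.

(** Only upper bounds [w'] on the degrees of the components of [B] are asked for, so the top
    component of the composition may vanish by cancellation. *)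
Lemma sub_graded (B : R * R * R) w w' P d :
  (gdeg w B.1.1 <= w'.1.1)%N -> (gdeg w B.1.2 <= w'.1.2)%N -> (gdeg w B.2 <= w'.2)%N ->
  (gdeg w' P <= d)%N ->
  (gdeg w (sub B P) <= d)%N /\
  gcomp w d (sub B P) =
    sub (gcomp w w'.1.1 B.1.1, gcomp w w'.1.2 B.1.2, gcomp w w'.2 B.2) (gcomp w' d P).
Proof.
move=> B1 B2 B3 Pd; set Bh := (_, _, _).
pose K Q e C := (gdeg w (sub B Q) <= e)%N /\ gcomp w e (sub B Q) = sub Bh C.
apply: (@graded_ind w' K) Pd; rewrite /K {K}.
- by move=> x; rewrite !subX gdeg_cst gcomp_cst.
- by rewrite !subX.
- by rewrite !subX.
- by rewrite !subX.
- move=> {}P {}d C [H _]; split; first exact: leqW.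
  by rewrite rmorph0 gcomp_small // ltnS.
- move=> {}P Q {}d C D [Pd EP] [Qd EQ]; rewrite (rmorphD (sub B)) (rmorphD (sub Bh)) gcompD.
  rewrite EP EQ; split=> //.
  exact: gdegD_le.
- move=> {}P Q {}d e C D [Pd EP] [Qe EQ]; rewrite (rmorphM (sub B)) (rmorphM (sub Bh)).
  rewrite gcompM_top // EP EQ; split=> //.
  exact: gdegM_le.
Qed.

Lemma sub_glead (B : R * R * R) w w' P :
  (gdeg w B.1.1 <= w'.1.1)%N -> (gdeg w B.1.2 <= w'.1.2)%N -> (gdeg w B.2 <= w'.2)%N ->
  let Bh := (gcomp w w'.1.1 B.1.1, gcomp w w'.1.2 B.1.2, gcomp w w'.2 B.2) in
  sub Bh (glead w' P) != 0 ->
  gdeg w (sub B P) = gdeg w' P /\ glead w (sub B P) = sub Bh (glead w' P).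
Proof.
move=> B1 B2 B3 Bh H.
have [le E] := sub_graded B1 B2 B3 (leqnn (gdeg w' P)).
have {}E : gcomp w (gdeg w' P) (sub B P) = sub Bh (glead w' P) by rewrite E.
suff D : gdeg w (sub B P) = gdeg w' P by rewrite -E -D.
apply/eqP; rewrite eqn_leq le leqNgt; apply: contra H => H.
by rewrite -E gcomp_small.
Qed.

End Grading.

(** * Locally nilpotent derivations and their leading parts *)

Section LocallyNilpotent.
Variables (k : fieldType) (M : pol3 k).
Local Notation R := (pol M).
Local Notation x1 := (px1 M).
Local Notation x2 := (px2 M).
Local Notation x3 := (px3 M).
Local Notation cst := (pcst M).
Implicit Types (D : R -> R) (P Q : R).

Definition derivation D :=
  [/\ forall P Q, D (P + Q) = D P + D Q,
      forall P Q, D (P * Q) = D P * Q + P * D Q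
    & forall x, D (cst x) = 0].
Definition lnd D := derivation D /\ forall P, exists m, iter m D P = 0.
Definition lnd_kills P Q :=
  exists D, [/\ lnd D, exists U, D U != 0, D P = 0 & D Q = 0].

(* The derivation with values f on the variables is the coefficient of t in
   P(X + t f). *)
Definition der_of (f : R * R * R) P : R :=
  (ev_in M (polyC \o cst) (x1%:P + f.1.1%:P * 'X) (x2%:P + f.1.2%:P * 'X)
         (x3%:P + f.2%:P * 'X) P)`_1.

Lemma der_of_derivation f : derivation (der_of f).
Proof.
rewrite /der_of; set Phi := ev_in _ _ _ _ _.
have Phi0 P : (Phi P)`_0 = P.
  have := @Pol_morph_ext _ M _ (coefp 0 \o Phi) idfun.
  apply=> [x|||] /=; rewrite /Phi (ev_in_cst, ev_in_X1, ev_in_X2, ev_in_X3) /coefp /=;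
    by rewrite ?coefD ?coefMX ?coefC /= ?addr0.
split=> [P Q|P Q|x]; first by rewrite rmorphD coefD.
- by rewrite rmorphM coefM big_ord_recl big_ord1 /= !Phi0 addrC.
- by rewrite /Phi ev_in_cst /= coefC.
Qed.

Lemma der_of_X1 f : der_of f x1 = f.1.1.
Proof. by rewrite /der_of ev_in_X1 coefD coefC coefMX coefC /= add0r. Qed.
Lemma der_of_X2 f : der_of f x2 = f.1.2.
Proof. by rewrite /der_of ev_in_X2 coefD coefC coefMX coefC /= add0r. Qed.
Lemma der_of_X3 f : der_of f x3 = f.2.
Proof. by rewrite /der_of ev_in_X3 coefD coefC coefMX coefC /= add0r. Qed.
Definition der_ofX := (der_of_X1, der_of_X2, der_of_X3).

Section Derivation.
Variables (D : R -> R) (derD : derivation D).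

Let DD P Q : D (P + Q) = D P + D Q. Proof. by case: derD. Qed.
Let DM P Q : D (P * Q) = D P * Q + P * D Q. Proof. by case: derD. Qed.
Let Dc x : D (cst x) = 0. Proof. by case: derD. Qed.

Lemma der0 : D 0 = 0. Proof. by rewrite -[X in D X](rmorph0 cst) Dc. Qed.

Lemma derN P : D (- P) = - D P.
Proof. by apply/eqP; rewrite -addr_eq0 -DD addNr der0. Qed.

Lemma derMn P n : D (P *+ n) = D P *+ n.
Proof. by elim: n => [|n IH]; rewrite ?mulr0n ?der0 // !mulrS DD IH. Qed.

Lemma der_sum I (r : seq I) (p : pred I) (F : I -> R) :
  D (\sum_(i <- r | p i) F i) = \sum_(i <- r | p i) D (F i).
Proof. exact: (big_morph D DD der0). Qed.

Lemma der_eq0 : D x1 = 0 -> D x2 = 0 -> D x3 = 0 -> forall P, D P = 0.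
Proof.
move=> D1 D2 D3; apply: Pol_ind => // P Q HP HQ.
  by rewrite DD HP HQ addr0.
by rewrite DM HP HQ mul0r mulr0 addr0.
Qed.

Lemma iter_der0 n : iter n D 0 = 0.
Proof. by elim: n => //= n ->; rewrite der0. Qed.

Lemma iter_derD n P Q : iter n D (P + Q) = iter n D P + iter n D Q.
Proof. by elim: n => //= n ->; rewrite DD. Qed.

Lemma iter_der_small m n P : (m <= n)%N -> iter m D P = 0 -> iter n D P = 0.
Proof. by move=> /subnK <- H; rewrite iterD H iter_der0. Qed.

Lemma iter_derM n P Q :
  iter n D (P * Q) = \sum_(i < n.+1) iter i D P * iter (n - i) D Q *+ 'C(n, i).
Proof.
elim: n => [|n IH]; first by rewrite big_ord1 bin0 mulr1n.
rewrite iterS IH der_sum.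
under eq_bigr => i _ do rewrite derMn DM mulrnDl -!iterS.
rewrite big_split /= [RHS]big_ord_recl /= bin0 mulr1n.
under [in RHS]eq_bigr => i _ do rewrite binS mulrnDr /bump /= subSS.
rewrite big_split /= addrA [LHS]addrC; congr (_ + _).
have E := big_ord_recl n.+1 (fun i => iter i D P * iter (n.+1 - i) D Q *+ 'C(n, i)).
rewrite /= bin0 mulr1n in E; rewrite -E {E} [RHS]big_ord_recr /= (bin_small (ltnSn n)) mulr0n addr0.
by apply: eq_bigr => i _; rewrite -iterS subSn // -ltnS.
Qed.

Lemma nilpotent_mul P Q m n :
  iter m D P = 0 -> iter n D Q = 0 -> iter (m + n) D (P * Q) = 0.
Proof.
move=> HP HQ; rewrite iter_derM big1 // => i _.
have [le|lt] := leqP m i; first by rewrite (iter_der_small le HP) mul0r mul0rn.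
by rewrite [iter (_ - _) _ _](@iter_der_small n) ?mulr0 ?mul0rn //; lia.
Qed.

(** By the Leibniz rule the elements killed by some iterate form a ring, so generators suffice; [F]
    allows generators other than the three variables. *)
Lemma nilpotent_gen (F : R * R * R) :
  (exists m, iter m D F.1.1 = 0) -> (exists m, iter m D F.1.2 = 0) ->
  (exists m, iter m D F.2 = 0) -> forall P, exists m, iter m D (sub F P) = 0.
Proof.
move=> F1 F2 F3; apply: Pol_ind => [x||||P Q [m Pm] [n Qn]|P Q [m Pm] [n Qn]]; rewrite ?subX //.
- by exists 1; rewrite /= Dc.
- exists (m + n)%N; rewrite rmorphD iter_derD.
  by rewrite (iter_der_small (leq_addr _ _) Pm) (iter_der_small (leq_addl _ _) Qn) addr0.
- exists (m + n)%N; rewrite rmorphM.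
  exact: nilpotent_mul.
Qed.

End Derivation.

Hypothesis char0 : [pchar k] =i pred0.

Lemma natr_cst_neq0 n : n.+1%:R != 0 :> R.
Proof.
rewrite -(rmorph_nat cst) fmorph_eq0.
by have /pcharf0P -> := char0.
Qed.

Lemma mulrSn_eq0 P n : P *+ n.+1 = 0 -> P = 0.
Proof.
by rewrite -mulr_natr => /eqP; rewrite mulf_eq0 (negPf (natr_cst_neq0 n)) orbF => /eqP.
Qed.

(* Top terms multiply: if D^m P and D^n Q are the last nonzero iterates, then
   D^(m+n)(PQ) = C(m+n,m) D^m P D^n Q. *)
Lemma lnd_factor_closed D P Q : lnd D -> P * Q != 0 -> D (P * Q) = 0 -> D P = 0.
Proof.
move=> [derD nil] PQ0 DPQ.
have last U : U != 0 -> exists m, iter m D U != 0 /\ iter m.+1 D U = 0.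
  move=> U0; have ex : exists m, iter m D U == 0 by have [m /eqP] := nil U; exists m.
  case: (ex_minnP ex) => [[|m]]; first by rewrite /= (negPf U0).
  move=> /eqP H Hmin; exists m; split=> //; apply/negP=> /Hmin; by rewrite ltnn.
have [P0 Q0] : P != 0 /\ Q != 0 by apply/andP; rewrite -negb_or -mulf_eq0.
have [m [Pm Pm1]] := last _ P0; have [n [Qn Qn1]] := last _ Q0.
have : iter (m + n) D (P * Q) != 0.
  rewrite iter_derM // (bigD1 (inord m)) //= inordK ?ltnS ?leq_addr // addKn.
  rewrite big1 ?addr0 => [|i Hi].
    have : (0 < 'C(m + n, m))%N by rewrite bin_gt0 leq_addr.
    case: 'C(_, _) => // c _; apply/negP => /eqP /mulrSn_eq0 /eqP.
    by rewrite mulf_eq0 (negPf Pm) (negPf Qn).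
  have im : nat_of_ord i != m.
    by apply: contraNneq Hi => E; apply/eqP/val_inj; rewrite /= inordK ?ltnS ?leq_addr.
  have [lt|ge] := ltnP m i; first by rewrite (iter_der_small derD lt Pm1) mul0r mul0rn.
  by rewrite [iter (_ - _) _ _](@iter_der_small _ derD n.+1) ?mulr0 ?mul0rn //; lia.
case: m Pm Pm1 => [|m] _ Pm1; first by [].
by rewrite (@iter_der_small _ derD 1) ?eqxx //.
Qed.

Section LeadingDerivation.
Variables (D : R -> R) (w : nat * nat * nat) (e : nat).
Hypotheses (derD : derivation D).
Hypotheses (D1 : (gdeg w (D x1) <= w.1.1 + e)%N) (D2 : (gdeg w (D x2) <= w.1.2 + e)%N)
           (D3 : (gdeg w (D x3) <= w.2 + e)%N).

(** The homogeneous part of [D] of weighted degree [e]; it is zero if no variable attains the bound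
    [e]. *)
Definition lead_der : R -> R :=
  der_of (gcomp w (w.1.1 + e) (D x1), gcomp w (w.1.2 + e) (D x2), gcomp w (w.2 + e) (D x3)).

Lemma lead_derP P d : (gdeg w P <= d)%N ->
  (gdeg w (D P) <= d + e)%N /\ gcomp w (d + e) (D P) = lead_der (gcomp w d P).
Proof.
move=> Pd; case: (derD) => DD DM Dc.
have [hD hM hc] := der_of_derivation (gcomp w (w.1.1 + e) (D x1),
  gcomp w (w.1.2 + e) (D x2), gcomp w (w.2 + e) (D x3)).
rewrite -/lead_der in hD hM hc.
pose K Q d C := [/\ (gdeg w Q <= d)%N, gcomp w d Q = C, (gdeg w (D Q) <= d + e)%N &
   gcomp w (d + e) (D Q) = lead_der C].
suff [_ _ ? ?] : K P d (gcomp w d P) by [].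
apply: (@graded_ind _ M w K) Pd; rewrite /K {K P d}.
- move=> x; rewrite gdeg_cst gcomp_cst Dc hc gdeg0; split=> //.
  by rewrite gcomp0.
- by rewrite gdeg_X1 gcomp_X1 /lead_der der_ofX.
- by rewrite gdeg_X2 gcomp_X2 /lead_der der_ofX.
- by rewrite gdeg_X3 gcomp_X3 /lead_der der_ofX.
- move=> P d C [H1 _ H2 _]; rewrite !gcomp_small ?ltnS // ?addSn ?ltnS //.
  split=> //; [exact: leqW|exact: leqW|].
  by rewrite /lead_der (der0 (der_of_derivation _)).
- move=> P Q d C C' [HP EP HDP EDP] [HQ EQ HDQ EDQ].
  by rewrite DD hD !gcompD EP EQ EDP EDQ; split=> //; apply: gdegD_le.
- move=> P Q d d' C C' [HP EP HDP EDP] [HQ EQ HDQ EDQ].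
  have H1 : (gdeg w (D P * Q)%R <= d + d' + e)%N by rewrite addnAC; apply: gdegM_le.
  have H2 : (gdeg w (P * D Q)%R <= d + d' + e)%N by rewrite -addnA; apply: gdegM_le.
  split; [exact: gdegM_le | by rewrite gcompM_top // EP EQ | by rewrite DM; exact: gdegD_le |].
  rewrite DM hM gcompD -{2}addnA addnAC !gcompM_top // EP EQ EDP EDQ //.
Qed.

Lemma lead_der_kills P : D P = 0 -> lead_der (glead w P) = 0.
Proof.
move=> DP; have [_] := lead_derP (leqnn (gdeg w P)).
by rewrite -gleadE DP gcomp0.
Qed.

Lemma iter_lead_der P d m : (gdeg w P <= d)%N ->
  (gdeg w (iter m D P) <= d + m * e)%N /\
  gcomp w (d + m * e) (iter m D P) = iter m lead_der (gcomp w d P).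
Proof.
move=> Pd; elim: m => [|m [H1 H2]]; first by rewrite mul0n addn0.
rewrite mulSn [(e + _)%N]addnC addnA !iterS.
by have [H3 H4] := lead_derP H1; rewrite H4 H2.
Qed.

(** Iterates of the leading part are top components of the iterates of [D], so on each variable they
    vanish once those do. *)
Lemma lead_der_lnd : (forall P, exists m, iter m D P = 0) -> lnd lead_der.
Proof.
move=> nil; have der : derivation lead_der by apply: der_of_derivation.
split=> // P; rewrite -[P]sub_id; move: P; apply: nilpotent_gen => //=.
- have [m Hm] := nil x1; exists m; rewrite -[in LHS](gcomp_X1 M w).
  have [_ <-] := iter_lead_der m (eq_leq (gdeg_X1 M w)).
  by rewrite Hm gcomp0.
- have [m Hm] := nil x2; exists m; rewrite -[in LHS](gcomp_X2 M w).
  have [_ <-] := iter_lead_der m (eq_leq (gdeg_X2 M w)).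
  by rewrite Hm gcomp0.
- have [m Hm] := nil x3; exists m; rewrite -[in LHS](gcomp_X3 M w).
  have [_ <-] := iter_lead_der m (eq_leq (gdeg_X3 M w)).
  by rewrite Hm gcomp0.
Qed.

End LeadingDerivation.

Lemma lnd_mul_kernel D C : lnd D -> D C = 0 -> lnd (fun P => C * D P).
Proof.
move=> [[DD DM Dc] nil] DC; split; first split.
- by move=> P Q; rewrite DD mulrDr.
- by move=> P Q; rewrite DM; ring.
- by move=> x; rewrite Dc mulr0.
move=> P; have [m Hm] := nil P; exists m.
have DCn n : D (C ^+ n) = 0.
  elim: n => [|n IH]; first by rewrite expr0 -(rmorph1 cst) Dc.
  by rewrite exprS DM IH DC mulr0 mul0r addr0.
have -> : iter m (fun P => C * D P) P = C ^+ m * iter m D P.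
  elim: {Hm} m => [|m IH]; first by rewrite mul1r.
  by rewrite /= IH DM DCn mul0r add0r exprS mulrA.
by rewrite Hm mulr0.
Qed.

(* Multiplying the derivation by a high power of P makes its weighted degree
   nonnegative. *)
Lemma lnd_kills_lead w P Q :
  (0 < gdeg w P)%N -> lnd_kills P Q -> lnd_kills (glead w P) (glead w Q).
Proof.
move=> P1 [D0 [lnd0 nz0 P0 Q0]].
have Pn0 : P != 0 by apply: contraTneq P1 => ->; rewrite gdeg0.
pose N := (w.1.1 + w.1.2 + w.2)%N.
pose D U := P ^+ N * D0 U.
have lndD : lnd D.
  apply: lnd_mul_kernel (lnd0) _; case: (lnd0) => [[_ DM Dc] _].
  elim: N {D} => [|N IH]; last by rewrite exprS DM IH P0 mul0r mulr0 addr0.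
  by rewrite expr0 -(rmorph1 cst) Dc.
have DP : D P = 0 by rewrite /D P0 mulr0.
have DQ : D Q = 0 by rewrite /D Q0 mulr0.
have nz U : D U != 0 -> (N <= gdeg w (D U))%N.
  rewrite /D => HU; have D0U : D0 U != 0 by apply: contraNneq HU => ->; rewrite mulr0.
  rewrite gdegM ?expf_neq0 //; apply: leq_trans (leq_addr _ _).
  elim: N {D lndD DP DQ HU} => // N IH; rewrite exprS gdegM ?expf_neq0 //.
  by rewrite -[N.+1]add1n leq_add.
(* A nonzero value of [D] has degree at least [N], hence at least every weight: the truncated
   subtractions lose nothing, and [e] is attained at a variable on which [D] is nonzero. *)
pose e := maxn (gdeg w (D x1) - w.1.1) (maxn (gdeg w (D x2) - w.1.2) (gdeg w (D x3) - w.2)).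
have D1 : (gdeg w (D x1) <= w.1.1 + e)%N by rewrite /e; lia.
have D2 : (gdeg w (D x2) <= w.1.2 + e)%N by rewrite /e; lia.
have D3 : (gdeg w (D x3) <= w.2 + e)%N by rewrite /e; lia.
exists (lead_der D w e); have [derD nil] := lndD; split; last 2 first.
- exact: lead_der_kills.
- exact: lead_der_kills.
- exact: lead_der_lnd.
have top d U : gdeg w U = d -> U != 0 -> gcomp w d U != 0.
  by move=> <- U0; rewrite -gleadE glead_eq0.
have pos U : (0 < gdeg w U)%N -> U != 0 by apply: contraTneq => ->; rewrite gdeg0.
have hit : [\/ gdeg w (D x1) = (w.1.1 + e)%N /\ D x1 != 0,
   gdeg w (D x2) = (w.1.2 + e)%N /\ D x2 != 0 | gdeg w (D x3) = (w.2 + e)%N /\ D x3 != 0].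
  have [e0|ep] := posnP e.
    have : [|| D x1 != 0, D x2 != 0 | D x3 != 0].
      rewrite -!negb_and; apply/negP => /and3P[/eqP h1 /eqP h2 /eqP h3].
      case: nz0 => U /negP[]; have /eqP := der_eq0 derD h1 h2 h3 U.
      by rewrite /D mulf_eq0 expf_eq0 (negPf Pn0) andbF.
    case/or3P => H; have := nz _ H; rewrite /N => H'; [apply: Or31|apply: Or32|apply: Or33];
      split=> //; lia.
  have : [\/ e = gdeg w (D x1) - w.1.1, e = gdeg w (D x2) - w.1.2 | e = gdeg w (D x3) - w.2]%N.
    have : [|| e == gdeg w (D x1) - w.1.1, e == gdeg w (D x2) - w.1.2
             | e == gdeg w (D x3) - w.2]%N by rewrite /e; lia.
    by case/or3P => /eqP; [apply: Or31 | apply: Or32 | apply: Or33].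
  by case=> E; [apply: Or31|apply: Or32|apply: Or33]; (split; [|apply: pos]); lia.
rewrite /lead_der; case: hit => [] [E H].
- by exists x1; rewrite der_ofX /=; apply: top.
- by exists x2; rewrite der_ofX /=; apply: top.
- by exists x3; rewrite der_ofX /=; apply: top.
Qed.

End LocallyNilpotent.

(** * Pairs of components of one automorphism *)

Section Components.
Variables (k : fieldType) (M : pol3 k).
Local Notation R := (pol M).
Local Notation x1 := (px1 M).
Local Notation x2 := (px2 M).
Local Notation x3 := (px3 M).
Local Notation cst := (pcst M).
Implicit Types (P Q : R).

Definition affine (a b c d : k) : R := cst a * x1 + cst b * x2 + cst c * x3 + cst d.

(** The two affine forms may be dependent, so a component is coprimary to itself and stationary
    moves are allowed. *)
Definition coprimary P Q := exists F F' : R * R * R, is_inv F F' /\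
  exists a b c d a' b' c' d',
    [/\ (a, b, c) != (0, 0, 0), (a', b', c') != (0, 0, 0),
        P = sub F (affine a b c d) & Q = sub F (affine a' b' c' d')].

Lemma px1_neq0 : x1 != 0.
Proof. by apply: contraTneq (isT : true) => E; have := gdeg_X1 M (1, 0, 0); rewrite E gdeg0. Qed.
Lemma px2_neq0 : x2 != 0.
Proof. by apply: contraTneq (isT : true) => E; have := gdeg_X2 M (0, 1, 0); rewrite E gdeg0. Qed.
Lemma px3_neq0 : x3 != 0.
Proof. by apply: contraTneq (isT : true) => E; have := gdeg_X3 M (0, 0, 1); rewrite E gdeg0. Qed.

Lemma cst_eq0 x : (cst x == 0) = (x == 0).
Proof. exact: fmorph_eq0. Qed.

(** The cross product serves unless it vanishes; then the second vector is a multiple of the first,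
    and any nonzero vector orthogonal to the first will do. *)
Lemma orthogonal_vector (a b c a' b' c' : k) : (a, b, c) != (0, 0, 0) ->
  exists u v w : k, [/\ (u, v, w) != (0, 0, 0), a * u + b * v + c * w = 0
    & a' * u + b' * v + c' * w = 0].
Proof.
move=> abc.
have [/eqP E|ne] := boolP ((b * c' - c * b', c * a' - a * c', a * b' - b * a') == (0, 0, 0));
  last by exists (b * c' - c * b'), (c * a' - a * c'), (a * b' - b * a'); split=> //; ring.
case: E => /eqP; rewrite subr_eq0 => /eqP E1 /eqP; rewrite subr_eq0 => /eqP E2 /eqP.
rewrite subr_eq0 => /eqP E3.
have [a0|an0] := eqVneq a 0.
  have [b0|bn0] := eqVneq b 0.
    exists 1, 0, 0; split.
    - by rewrite !xpair_eqE oner_eq0.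
    - by rewrite a0 !(mulr0, mul0r, addr0).
    - have cn0 : c != 0 by apply: contraNneq abc => ->; rewrite a0 b0.
      by rewrite !mulr0 !addr0 mulr1; apply: (mulfI cn0); rewrite E2 a0 mul0r mulr0.
  exists b, (- a), 0; split; [by rewrite !xpair_eqE (negPf bn0)|by ring|].
  by rewrite mulr0 addr0 mulrN [b' * a]mulrC E3 mulrC subrr.
have [b0|bn0] := eqVneq b 0.
  exists c, 0, (- a); split; [by rewrite !xpair_eqE oppr_eq0 (negPf an0) andbF|by ring|].
  by rewrite mulr0 addr0 mulrN [a' * c]mulrC E2 mulrC subrr.
exists b, (- a), 0; split; [by rewrite !xpair_eqE (negPf bn0)|by ring|].
by rewrite mulr0 addr0 mulrN [b' * a]mulrC E3 mulrC subrr.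
Qed.

Lemma der_of_affine (u v w : k) a b c d :
  der_of (cst u, cst v, cst w) (affine a b c d) = cst (a * u + b * v + c * w).
Proof.
have [DD DM Dc] := der_of_derivation (cst u, cst v, cst w).
rewrite /affine !DD !DM !Dc !der_ofX /= !mul0r !add0r addr0.
by rewrite !rmorphD !rmorphM.
Qed.

(** A constant vector field tangent to the levels of both affine forms, transported by [F]. *)
Lemma coprimary_lnd P Q : coprimary P Q -> lnd_kills P Q.
Proof.
case=> F [F' [FF' [a [b [c [d [a' [b' [c' [d' [abc abc' -> ->]]]]]]]]]]].
have [u [v [w [uvw E E']]]] := orthogonal_vector a' b' c' abc.
pose f := (cst u, cst v, cst w).
pose D U := sub F (der_of f (sub F' U)).
have [dD dM dc] := der_of_derivation f.
have DF U : D (sub F U) = sub F (der_of f U) by rewrite /D (sub_inv _ (is_invC FF')).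
have derD : derivation D.
  split=> [U V|U V|x]; rewrite /D ?sub_cst ?dc ?rmorph0 //.
    by rewrite rmorphD dD rmorphD.
  by rewrite rmorphM dM rmorphD !rmorphM !(sub_inv _ FF').
have D1 : D F.1.1 = cst u by rewrite -[F.1.1](sub_X1 F) DF der_ofX sub_cst.
have D2 : D F.1.2 = cst v by rewrite -[F.1.2](sub_X2 F) DF der_ofX sub_cst.
have D3 : D F.2 = cst w by rewrite -[F.2](sub_X3 F) DF der_ofX sub_cst.
exists D; split.
- split=> // U; rewrite -[U](sub_inv _ FF'); apply: nilpotent_gen => //;
    by exists 2; rewrite /= ?D1 ?D2 ?D3; case: derD.
- have [u0|un0] := eqVneq u 0; last by exists F.1.1; rewrite D1 cst_eq0.
  have [v0|vn0] := eqVneq v 0; last by exists F.1.2; rewrite D2 cst_eq0.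
  have [w0|wn0] := eqVneq w 0; last by exists F.2; rewrite D3 cst_eq0.
  by move: uvw; rewrite u0 v0 w0 eqxx.
- by rewrite DF der_of_affine E rmorph0 rmorph0.
- by rewrite DF der_of_affine E' rmorph0 rmorph0.
Qed.

Lemma coprimary_sub (S S' : R * R * R) P Q :
  is_inv S S' -> coprimary P Q -> coprimary (sub S P) (sub S Q).
Proof.
move=> SS' [F [F' [FF' [a [b [c [d [a' [b' [c' [d' [abc abc' -> ->]]]]]]]]]]]].
exists (pcomp F S), (pcomp S' F'); split; first exact: is_inv_comp.
by exists a, b, c, d, a', b', c', d'; rewrite !sub_comp.
Qed.

Lemma coprimary_sym P Q : coprimary P Q -> coprimary Q P.
Proof.
case=> F [F' [FF' [a [b [c [d [a' [b' [c' [d' [abc abc' -> ->]]]]]]]]]]].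
by exists F, F'; split=> //; exists a', b', c', d', a, b, c, d.
Qed.

Lemma coprimaryl P Q : coprimary P Q -> coprimary P P.
Proof.
case=> F [F' [FF' [a [b [c [d [a' [b' [c' [d' [abc abc' -> _]]]]]]]]]]].
by exists F, F'; split=> //; exists a, b, c, d, a, b, c, d.
Qed.

Lemma affine_neq_cst a b c d x : (a, b, c) != (0, 0, 0) -> affine a b c d <> cst x.
Proof.
move=> abc E; move: abc; apply/negP; rewrite negbK.
have C0 y : cst y = mon M y 0 0 0 by rewrite /mon !expr0 !mulr1.
have C1 : cst a * x1 = mon M a 1 0 0 by rewrite /mon expr1 !expr0 !mulr1.
have C2 : cst b * x2 = mon M b 0 1 0 by rewrite /mon expr1 !expr0 !mulr1.
have C3 : cst c * x3 = mon M c 0 0 1 by rewrite /mon expr1 !expr0 !mulr1.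
rewrite /affine C1 C2 C3 !C0 in E.
have E1 := congr1 (fun P => cf P 1 0 0) E; have E2 := congr1 (fun P => cf P 0 1 0) E.
have E3 := congr1 (fun P => cf P 0 0 1) E.
move: E1 E2 E3; rewrite !cfD !cf_mon /= !addr0 !add0r => -> -> ->; exact: eqxx.
Qed.

Lemma gdeg_gt0 w P : (0 < w.1.1)%N -> (0 < w.1.2)%N -> (0 < w.2)%N ->
  (forall x, P <> cst x) -> (0 < gdeg w P)%N.
Proof.
move=> w1 w2 w3 Pc; rewrite lt0n; apply/negP => /eqP E.
case: (Pc (cf P 0 0 0)); apply: cfP => a b c.
have -> : cst (cf P 0 0 0) = mon M (cf P 0 0 0) 0 0 0 by rewrite /mon !expr0 !mulr1.
rewrite cf_mon; have [/and3P[/eqP-> /eqP-> /eqP->] //|abc] := ifP.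
apply/eqP/negPn/negP => H; have := (gdegP w P 0).1; rewrite E => /(_ isT a b c H).
by rewrite /wdot leqn0 !addn_eq0 !muln_eq0; move: abc w1 w2 w3; lia.
Qed.

Lemma coprimary_nonconst P Q x : coprimary P Q -> P <> cst x.
Proof.
case=> F [F' [FF' [a [b [c [d [a' [b' [c' [d' [abc abc' -> _]]]]]]]]]]] E.
apply: (affine_neq_cst (d := d) (x := x) abc).
by rewrite -[LHS](sub_inv _ (is_invC FF')) E sub_cst.
Qed.

Lemma sub_congr (A B : R * R * R) d P :
  (exists U, A.1.1 - B.1.1 = U * d) -> (exists U, A.1.2 - B.1.2 = U * d) ->
  (exists U, A.2 - B.2 = U * d) -> exists U, sub A P - sub B P = U * d.
Proof.
move=> H1 H2 H3; move: P; apply: Pol_ind => [x||||P Q [U HU] [V HV]|P Q [U HU] [V HV]];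
  rewrite ?subX //.
- by exists 0; rewrite subrr mul0r.
- by exists (U + V); rewrite !rmorphD mulrDl -HU -HV; ring.
- exists (U * sub A Q + sub B P * V); rewrite !rmorphM.
  transitivity (U * d * sub A Q + sub B P * (V * d)); last by ring.
  by rewrite -HU -HV; ring.
Qed.

(** A substitution congruent to the identity modulo [d] changes [P] only by a multiple of [d]. *)
Lemma retract_factor (B : R * R * R) d P :
  (exists U, x1 - B.1.1 = U * d) -> (exists U, x2 - B.1.2 = U * d) ->
  (exists U, x3 - B.2 = U * d) -> sub B P = 0 -> exists U, P = U * d.
Proof.
move=> H1 H2 H3 E; have [U] := @sub_congr (pid M) B d P H1 H2 H3.
by rewrite sub_id E subr0; exists U.
Qed.

End Components.

(** * The effect of g and h on leading forms, and the two forbidden divisors *)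

Section Steps.
Variables (k : fieldType) (M : pol3 k).
Hypothesis char0 : [pchar k] =i pred0.
Local Notation R := (pol M).
Local Notation x1 := (px1 M).
Local Notation x2 := (px2 M).
Local Notation x3 := (px3 M).
Local Notation cst := (pcst M).
Implicit Types (P Q H : R) (w : nat * nat * nat).

Definition mapG : R * R * R := (x2, x1 + x2 * x3, x3).
Definition mapg : R * R * R := (x2 - x1 * x3, x1, x3).
Definition maph : R * R * R := (x2, x3, x1).
Definition maphV : R * R * R := (x3, x1, x2).

Lemma inv_g : is_inv mapg mapG.
Proof.
split; rewrite /pcomp /mapg /mapG /pid /= !(rmorphD, rmorphN, rmorphM, subX) /=;
  by congr (_, _, _); ring.
Qed.

Lemma inv_h : is_inv maph maphV.
Proof. by split; rewrite /pcomp /maph /maphV /pid /= !subX. Qed.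

(* The retractions onto the surfaces x2 = x1 x3 and x3 = x1 x2 detect
   divisibility by x2 - x1 x3 and by x3 - x1 x2. *)
Definition retr_g : {rmorphism R -> R} := sub (x1, x1 * x3, x3).
Definition retr_X : {rmorphism R -> R} := sub (x1, x2, x1 * x2).
(** The leading part of [mapG] when x2 x3 outweighs x1. It parametrizes the surface x2 = x1 x3, so
    it has the same kernel as [retr_g]. *)
Definition lead_g : {rmorphism R -> R} := sub (x2, x2 * x3, x3).

Lemma retr_gP P : retr_g P = 0 -> exists U, P = U * (x2 - x1 * x3).
Proof.
apply: retract_factor => /=; first by exists 0; rewrite subrr mul0r.
  by exists 1; rewrite mul1r.
by exists 0; rewrite subrr mul0r.
Qed.

Lemma retr_XP P : retr_X P = 0 -> exists U, P = U * (x3 - x1 * x2).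
Proof.
apply: retract_factor => /=; try by exists 0; rewrite subrr mul0r.
by exists 1; rewrite mul1r.
Qed.

Lemma x3_factor P : sub (x1, x2, 0) P = 0 -> exists U, P = U * x3.
Proof.
apply: retract_factor => /=; try by exists 0; rewrite subrr mul0r.
by exists 1; rewrite mul1r subr0.
Qed.

Lemma x2_factor P : sub (x1, 0, x3) P = 0 -> exists U, P = U * x2.
Proof.
apply: retract_factor => /=; try by exists 0; rewrite subrr mul0r.
by exists 1; rewrite mul1r subr0.
Qed.

Lemma retr_X_h P : retr_X (sub maph P) = sub maph (retr_g P).
Proof. by rewrite !sub_comp /pcomp /= !rmorphM !subX /= mulrC. Qed.

Lemma retr_X_h_eq0 P : (retr_X (sub maph P) == 0) = (retr_g P == 0).
Proof.
rewrite retr_X_h -{1}(rmorph0 (sub maph)).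
exact: (inj_eq (sub_inj inv_h)).
Qed.

Lemma lead_g_eq0 P : (lead_g P == 0) = (retr_g P == 0).
Proof.
have inv_swap : is_inv (x2, x1, x3) (x2, x1, x3).
  by split; rewrite /pcomp /pid /= !subX.
have -> : lead_g P = sub (x2, x1, x3) (retr_g P).
  by rewrite sub_comp /pcomp /= !rmorphM !subX.
by rewrite -{1}(rmorph0 (sub (x2, x1, x3))) (inj_eq (sub_inj inv_swap)).
Qed.

(** The weights (1,0,0) measure the degree in x1. *)
Lemma gdeg_lead_g P : gdeg (1, 0, 0) (lead_g P) = 0%N.
Proof.
suff E : grade M (1, 0, 0) (lead_g P) = (lead_g P)%:P.
  by rewrite gdegE E size_polyC; case: (_ != 0).
have := @Pol_morph_ext _ M _ (grade M (1, 0, 0) \o lead_g) (polyC \o lead_g).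
apply=> [x|||] /=; rewrite /lead_g !subX ?gradeX //= ?rmorphM /= ?gradeX /= ?expr0 ?mulr1 //.
Qed.

Lemma gdeg_sub_top P Q : gdeg (1, 0, 0) P = 0%N -> gdeg (1, 0, 0) (P - x1 * Q) = 0%N -> Q = 0.
Proof.
move=> P0 PQ; apply/eqP; apply: contraTT isT => Q0.
have : gdeg (1, 0, 0) (x1 * Q) = 0%N.
  apply/eqP; rewrite -leqn0; have -> : x1 * Q = P + - 1 * (P - x1 * Q) by ring.
  apply: gdegD_le; rewrite ?P0 // -[0%N]/(0 + 0)%N; apply: gdegM_le; rewrite ?PQ //.
  by rewrite -(rmorph1 cst) -rmorphN gdeg_cst.
by rewrite gdegM ?px1_neq0 // gdeg_X1.
Qed.

(** The divisor has positive degree in x1, so it divides no nonzero polynomial free of x1; the same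
    holds for x3 - x1 x2 below. *)
Lemma gdeg100_factor_g P U : gdeg (1, 0, 0) P = 0%N -> P = U * (x2 - x1 * x3) -> P = 0.
Proof.
move=> P0 E; apply/eqP; apply: contraTT isT => Pn0; move: (Pn0).
rewrite {1}E mulf_eq0 negb_or => /andP[U0 d0].
have := P0; rewrite E gdegM // => /eqP; rewrite addn_eq0 => /andP[_ /eqP H].
have := @gdeg_sub_top x2 x3; rewrite gdeg_X2 H => /(_ erefl erefl) /eqP.
by rewrite (negPf (px3_neq0 M)).
Qed.

Lemma gdeg100_factor_X P U : gdeg (1, 0, 0) P = 0%N -> P = U * (x3 - x1 * x2) -> P = 0.
Proof.
move=> P0 E; apply/eqP; apply: contraTT isT => Pn0; move: (Pn0).
rewrite {1}E mulf_eq0 negb_or => /andP[U0 d0].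
have := P0; rewrite E gdegM // => /eqP; rewrite addn_eq0 => /andP[_ /eqP H].
have := @gdeg_sub_top x3 x2; rewrite gdeg_X3 H => /(_ erefl erefl) /eqP.
by rewrite (negPf (px2_neq0 M)).
Qed.

Lemma retr_g_lead_g P : lead_g P != 0 -> retr_g (lead_g P) != 0.
Proof.
apply: contra => /eqP/retr_gP[U E]; apply/eqP; apply: gdeg100_factor_g E.
exact: gdeg_lead_g.
Qed.

Lemma retr_X_lead_g P : lead_g P != 0 -> retr_X (lead_g P) != 0.
Proof.
apply: contra => /eqP/retr_XP[U E]; apply/eqP; apply: gdeg100_factor_X E.
exact: gdeg_lead_g.
Qed.

(* If P has weights w, then P(g) has weights [wG w] and P(h) weights [wh w]: these
   are the weighted degrees of the components of g^-1 and h^-1. *)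
Definition wG w : nat * nat * nat := (w.1.2, w.1.2 + w.2, w.2)%N.
Definition wh w : nat * nat * nat := (w.2, w.1.1, w.1.2).
(** The last inequality makes x2 x3 the leading term of x1 + x2 x3. *)
Definition wok w := [&& 0 < w.1.1, 0 < w.1.2, 0 < w.2 & w.1.1 < w.1.2 + w.2]%N.

Lemma wokG w : wok w -> wok (wG w).
Proof. by rewrite /wok /wG /=; lia. Qed.

Lemma wok_iterG w n : wok w -> wok (iter n wG w).
Proof. by move=> H; elim: n => //= n; apply: wokG. Qed.

(** [P] is recovered from P o g by composing with g^-1; its leading form follows from that of P o g
    because [lead_g] does not annihilate the latter. *)
Lemma glead_G w P : wok w -> retr_g (glead (wG w) (sub mapg P)) != 0 ->
  gdeg w P = gdeg (wG w) (sub mapg P) /\ glead w P = lead_g (glead (wG w) (sub mapg P)).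
Proof.
move=> wokw H; set P' := sub mapg P in H *.
have -> : P = sub mapG P' by rewrite (sub_inv _ (is_invC inv_g)).
have d23 : gdeg w (x2 * x3) = (w.1.2 + w.2)%N.
  by rewrite gdegM ?px2_neq0 ?px3_neq0 // gdeg_X2 gdeg_X3.
have lt : (w.1.1 < w.1.2 + w.2)%N by case/and4P: wokw.
have := @sub_glead _ M mapG w (wG w) P'; rewrite /mapG /= gdeg_X2 gdeg_X3 !gcompX gcompD.
rewrite gcompM_top ?gdeg_X2 ?gdeg_X3 // !gcompX [gcomp _ _ x1]gcomp_small ?gdeg_X1 // add0r.
apply=> //; first by apply: gdegD_le; rewrite ?gdeg_X1 ?d23 // ltnW.
by move: H; rewrite -lead_g_eq0.
Qed.

(** The leading form of [P] lies in the image of [lead_g], so it is free of x1 and avoids both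
    divisors. Survival thus passes to lower powers of g. *)
Lemma retr_g_G w P : wok w -> retr_g (glead (wG w) (sub mapg P)) != 0 ->
  retr_g (glead w P) != 0 /\ retr_X (glead w P) != 0.
Proof.
move=> wokw H; have [_ E] := glead_G wokw H.
have nz : lead_g (glead (wG w) (sub mapg P)) != 0 by rewrite lead_g_eq0.
by rewrite E; split; [exact: retr_g_lead_g | exact: retr_X_lead_g].
Qed.

Lemma retr_g_iter w P m n : wok w -> (m <= n)%N ->
  retr_g (glead (iter n wG w) (iter n (sub mapg) P)) != 0 ->
  retr_g (glead (iter m wG w) (iter m (sub mapg) P)) != 0.
Proof.
move=> wokw /subnK <-; elim: (n - m)%N => // l IH.
by rewrite addSn /= => /(retr_g_G (wok_iterG _ wokw))[/IH].
Qed.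

Lemma glead_h w P :
  gdeg w P = gdeg (wh w) (sub maph P) /\ sub maph (glead w P) = glead (wh w) (sub maph P).
Proof.
set P' := sub maph P.
have -> : P = sub maphV P' by rewrite (sub_inv _ (is_invC inv_h)).
have [P0|P'0] := eqVneq P' 0.
  by rewrite P0 rmorph0 !gdeg0 !gleadE !gdeg0 !gcomp0 rmorph0.
have := @sub_glead _ M maphV w (wh w) P'; rewrite /maphV /= gdeg_X1 gdeg_X2 gdeg_X3 !gcompX.
rewrite -/maphV => /(_ (leqnn _) (leqnn _) (leqnn _)) [].
  rewrite -(rmorph0 (sub maphV)) (inj_eq (sub_inj (is_invC inv_h))).
  by rewrite glead_eq0.
by move=> -> ->; rewrite (sub_inv _ inv_h).
Qed.

Lemma retr_X_glead_h w P :
  (retr_X (glead (wh w) (sub maph P)) == 0) = (retr_g (glead w P) == 0).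
Proof. by rewrite -(glead_h w P).2 retr_X_h_eq0. Qed.

(** A kernel that contains x3 and x3 - x1 x2 contains x1 x2, hence by factorial closedness all three
    variables. *)
Lemma lnd_kills_L1 P Q U V : lnd_kills P Q -> P != 0 -> Q != 0 ->
  P = U * (x3 - x1 * x2) -> Q = V * x3 -> False.
Proof.
case=> D [lndD [W DW] DP DQ] P0 Q0 EP EQ.
have [derD _] := lndD; have [DD DM _] := derD.
have D3 : D x3 = 0.
  by apply: (@lnd_factor_closed _ M char0 D x3 V) => //; rewrite mulrC -EQ.
have D12 : D (x3 - x1 * x2) = 0.
  by apply: (@lnd_factor_closed _ M char0 D _ U) => //; rewrite mulrC -EP.
have {}D12 : D (x1 * x2) = 0.
  by move: D12; rewrite DD (derN derD) D3 add0r => /eqP; rewrite oppr_eq0 => /eqP.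
have n12 : x1 * x2 != 0 by rewrite mulf_neq0 ?px1_neq0 ?px2_neq0.
have D1 := lnd_factor_closed char0 lndD n12 D12.
have D2 : D x2 = 0.
  by apply: (@lnd_factor_closed _ M char0 D x2 x1) => //; rewrite mulrC.
by move: DW; rewrite (der_eq0 derD) ?eqxx.
Qed.

Lemma lnd_kills_L2 P Q U V : lnd_kills P Q -> P != 0 -> Q != 0 ->
  P = U * (x2 - x1 * x3) -> Q = V * x2 -> False.
Proof.
case=> D [lndD [W DW] DP DQ] P0 Q0 EP EQ.
have [derD _] := lndD; have [DD DM _] := derD.
have D2 : D x2 = 0.
  by apply: (@lnd_factor_closed _ M char0 D x2 V) => //; rewrite mulrC -EQ.
have D13 : D (x2 - x1 * x3) = 0.
  by apply: (@lnd_factor_closed _ M char0 D _ U) => //; rewrite mulrC -EP.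
have {}D13 : D (x1 * x3) = 0.
  by move: D13; rewrite DD (derN derD) D2 add0r => /eqP; rewrite oppr_eq0 => /eqP.
have n13 : x1 * x3 != 0 by rewrite mulf_neq0 ?px1_neq0 ?px3_neq0.
have D1 := lnd_factor_closed char0 lndD n13 D13.
have D3 : D x3 = 0.
  by apply: (@lnd_factor_closed _ M char0 D x3 x1) => //; rewrite mulrC.
by move: DW; rewrite (der_eq0 derD) ?eqxx.
Qed.

Lemma cf_sub_axis P a b c :
  cf (sub (0, 0, x3) P) a b c = if (a == 0) && (b == 0) then cf P 0 0 c else 0.
Proof.
move: P; apply: mon_ind => [|P Q IHP IHQ|x a' b' c'].
- by rewrite rmorph0 !cf0 if_same.
- by rewrite rmorphD !cfD IHP IHQ; case: ifP => // _; rewrite addr0.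
rewrite !rmorphM !rmorphXn !subX /= !expr0n.
have -> : cst x * (a' == 0)%:R * (b' == 0)%:R * x3 ^+ c' =
    mon M (x * (a' == 0)%:R * (b' == 0)%:R) 0 0 c'.
  by rewrite /mon !expr0 !mulr1 !rmorphM /= !rmorph_nat.
rewrite !cf_mon; case: (a' == 0) (eq_sym 0%N a') => -> ; case: (b' == 0) (eq_sym 0%N b') => ->;
  rewrite /= ?mulr0 ?mul0r ?mulr1 ?if_same //.
by case: (a == 0); case: (b == 0).
Qed.

Lemma sub_origin P : sub (0, 0, 0) P = cst (cf P 0 0 0).
Proof.
have C y : cst y = mon M y 0 0 0 by rewrite /mon !expr0 !mulr1.
move: P; apply: mon_ind => [|P Q IHP IHQ|x a b c].
- by rewrite rmorph0 cf0 rmorph0.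
- by rewrite rmorphD cfD rmorphD IHP IHQ.
rewrite !rmorphM !rmorphXn !subX /= !expr0n cf_mon.
by case: a => [|a]; case: b => [|b]; case: c => [|c]; rewrite ?mulr0 ?mul0r ?mulr1 ?rmorph0.
Qed.

Lemma sub_origin_glead w P : (0 < gdeg w P)%N -> sub (0, 0, 0) (glead w P) = 0.
Proof.
move=> Pd; rewrite sub_origin cf_glead /wdot !muln0 !addn0.
by rewrite eq_sym (gtn_eqF Pd) rmorph0.
Qed.

End Steps.

(** * Survival of leading forms along the factors of f *)

Section Chains.
Variables (k : fieldType) (M : pol3 k).
Hypothesis char0 : [pchar k] =i pred0.
Local Notation R := (pol M).
Local Notation x1 := (px1 M).
Local Notation x2 := (px2 M).
Local Notation x3 := (px3 M).
Local Notation cst := (pcst M).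
Local Notation mapg := (mapg M).
Local Notation maph := (maph M).
Local Notation retr_g := (retr_g M).
Local Notation retr_X := (retr_X M).
Local Notation lead_g := (lead_g M).
Implicit Types (P Q H : R) (w : nat * nat * nat) (N m r : nat).

(** On monomials of total degree below [N] these weights compare lexicographically, first a + b and
    then b + c. *)
Definition wS N : nat * nat * nat := (N, N.+1, 1%N).
Definition small N P := forall a b c, cf P a b c != 0 -> (a + b + c < N)%N.

Lemma wok_S N : (0 < N)%N -> wok (wS N).
Proof. by rewrite /wok /wS /=; lia. Qed.

Lemma iter_wG r w : iter r.+1 wG w = (w.1.2 + r * w.2, w.1.2 + r.+1 * w.2, w.2)%N.
Proof.
elim: r => [|r IH]; first by rewrite /= /wG mul0n addn0 mul1n.
by rewrite iterS IH /wG /=; congr (_, _, _); lia.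
Qed.

Lemma iter_wG_S r N : iter r wG (wS N) = (N + r, (N + r).+1, 1)%N.
Proof.
case: r => [|r]; first by rewrite addn0.
by rewrite iter_wG /wS /=; congr (_, _, _); lia.
Qed.

Lemma cf_der3 P a b c : cf (der_of (0, 0, 1) P) a b c = cf P a b c.+1 *+ c.+1.
Proof.
have derD := der_of_derivation ((0, 0, 1) : R * R * R); have [DD DM Dc] := derD.
set D := der_of _ in derD DD DM Dc *.
have DX n : D (x3 ^+ n) = x3 ^+ n.-1 *+ n.
  elim: n => [|n IH]; first by rewrite expr0 mulr0n -(rmorph1 cst) Dc.
  rewrite exprS DM IH /D der_of_X3 /= mul1r mulrnAr -exprS mulrS.
  by case: n {IH} => [|n]; rewrite ?mulr0n.
have D0 Q : D x1 = 0 -> D x2 = 0 -> forall a b x, D (cst x * x1 ^+ a * x2 ^+ b) = 0.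
  move=> D1 D2.
  have Xn y n : D y = 0 -> D (y ^+ n) = 0.
    move=> Dy; elim: n => [|n IH]; first by rewrite expr0 -(rmorph1 cst) Dc.
    by rewrite exprS DM Dy IH mul0r mulr0 addr0.
  by move=> a' b' x; rewrite !DM Dc !Xn // !mul0r !mulr0 !addr0 mul0r.
have {}D0 := D0 0 (der_of_X1 _) (der_of_X2 _).
move: P; apply: mon_ind => [|P Q IHP IHQ|x a' b' c'].
- by rewrite (der0 derD) !cf0 mul0rn.
- by rewrite DD !cfD IHP IHQ mulrnDl.
rewrite DM D0 mul0r add0r DX.
have -> : cst x * x1 ^+ a' * x2 ^+ b' * (x3 ^+ c'.-1 *+ c') = mon M (x *+ c') a' b' c'.-1.
  by rewrite /mon rmorphMn /= mulrnAr -!mulrnAl.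
rewrite !cf_mon; case: c' => [|c']; first by rewrite mulr0n !if_same andbF andbF mul0rn.
by rewrite /= eqSS; case: and3P => [[_ _ /eqP->]|_]; rewrite ?mul0rn.
Qed.

Lemma cf_mulX1 P b c : cf (x1 * P) 0 b c = 0.
Proof.
move: P; apply: mon_ind => [|P Q IHP IHQ|x a' b' c'].
- by rewrite mulr0 cf0.
- by rewrite mulrDr cfD IHP IHQ addr0.
have -> : x1 * (cst x * x1 ^+ a' * x2 ^+ b' * x3 ^+ c') = mon M x a'.+1 b' c'.
  by rewrite /mon exprS; ring.
by rewrite cf_mon.
Qed.

Lemma glead_cubic : glead (1, 1, 0) (x3 - x1 * x2) = - (x1 * x2) /\
  gdeg (1, 1, 0) (x3 - x1 * x2) = 2%N.
Proof.
have E : x3 - x1 * x2 = x3 + cst (-1) * (x1 * x2) by rewrite rmorphN rmorph1 mulN1r.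
have d12 : gdeg (1, 1, 0) (x1 * x2) = 2%N.
  by rewrite gdegM ?px1_neq0 ?px2_neq0 // gdeg_X1 gdeg_X2.
have le2 : (gdeg (1, 1, 0) (x3 - x1 * x2) <= 2)%N.
  rewrite E; apply: gdegD_le; first by rewrite gdeg_X3.
  by rewrite -[2%N]/(0 + 2)%N; apply: gdegM_le; rewrite ?gdeg_cst ?d12.
have c2 : gcomp (1, 1, 0) 2 (x3 - x1 * x2) = - (x1 * x2).
  rewrite E gcompD gcomp_small ?gdeg_X3 // add0r.
  have := @gcompM_top _ M (1, 1, 0) (cst (-1)) (x1 * x2) 0 2; rewrite add0n gdeg_cst d12.
  move=> -> //; rewrite gcomp_cst rmorphN rmorph1 mulN1r.
  have := @gcompM_top _ M (1, 1, 0) x1 x2 1 1; rewrite gdeg_X1 gdeg_X2 => -> //.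
  by have := gcomp_X1 M (1, 1, 0) => /= ->; have := gcomp_X2 M (1, 1, 0) => /= ->.
have d : gdeg (1, 1, 0) (x3 - x1 * x2) = 2%N.
  apply/eqP; rewrite eqn_leq le2 leqNgt; apply/negP => lt.
  move/eqP: c2; rewrite gcomp_small // eq_sym oppr_eq0 mulf_eq0.
  by rewrite (negPf (px1_neq0 M)) (negPf (px2_neq0 M)).
by rewrite gleadE d c2.
Qed.

(* The leading form for the weights (1,1,0) of a form divisible by x3 - x1 x2 is
   divisible by x1 x2; as it is killed by a derivation, it cannot involve x3. *)
Lemma lnd_cubic_monomial P U : P != 0 -> P = U * (x3 - x1 * x2) -> lnd_kills P P ->
  exists a b, (0 < a)%N /\ cf P a b 0 != 0.
Proof.
move=> P0 E killP; have [lc dc] := glead_cubic.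
have := P0; rewrite {1}E mulf_eq0 negb_or => /andP[U0 d0].
have dP : (0 < gdeg (1, 1, 0) P)%N by rewrite E gdegM // dc addn2.
have [D [lndD [W DW] DZ _]] := lnd_kills_lead dP killP.
set Z := glead _ P in DZ; have Z0 : Z != 0 by rewrite glead_eq0.
have EZ : Z = x1 * (x2 * - glead (1, 1, 0) U).
  by rewrite /Z E gleadM lc; ring.
have [derD _] := lndD; have [DD DM Dc] := derD.
have D1 : D x1 = 0.
  by apply: (lnd_factor_closed char0 lndD (Q := x2 * - glead (1, 1, 0) U)); rewrite -EZ.
have D2 : D x2 = 0.
  by apply: (lnd_factor_closed char0 lndD (Q := x1 * - glead (1, 1, 0) U)); rewrite mulrCA -EZ.
have [dD dM dc'] := der_of_derivation ((0, 0, 1) : R * R * R).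
(* A derivation killing x1 and x2 is a multiple of d/dx3, so a nonzero one detects every occurrence
   of x3. *)
have DE Q : D Q = der_of (0, 0, 1) Q * D x3.
  move: Q; apply: Pol_ind => [x||||P' Q' IHP IHQ|P' Q' IHP IHQ].
  - by rewrite Dc dc' mul0r.
  - by rewrite der_of_X1 D1 mul0r.
  - by rewrite der_of_X2 D2 mul0r.
  - by rewrite der_of_X3 mul1r.
  - by rewrite DD dD IHP IHQ mulrDl.
  - by rewrite DM dM IHP IHQ; ring.
have D3 : D x3 != 0 by apply: contraNneq DW => E3; rewrite DE E3 mulr0.
move: DZ; rewrite DE => /eqP; rewrite mulf_eq0 (negPf D3) orbF => /eqP dZ.
have [a [b [c Zabc]]] := cf_neq0 Z0.
have c0 : c = 0%N.
  case: c Zabc => // c /negP[]; have := cf_der3 Z a b c; rewrite dZ cf0.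
  move=> /esym/eqP; rewrite -mulr_natr mulf_eq0.
  by have /pcharf0P -> := char0; rewrite orbF.
exists a, b; rewrite c0 in Zabc; split.
  by case: a Zabc => //; rewrite EZ cf_mulX1 eqxx.
by move: Zabc; rewrite cf_glead; case: ifP => // _; rewrite eqxx.
Qed.

(* For the weights (N, N+1, 1) the leading form of P is a multiple of x2^s x3^t, which
   bounds the degree of P in x1 and x2 together by s.  As w1 < w2, a monomial x1^a x2^b
   of P with a > 0 then has lower degree than x2^s x3^t for the weights w. *)
Lemma left_barrier w P N : wok w -> (w.1.1 < w.1.2)%N -> lnd_kills P P ->
  (0 < gdeg w P)%N -> (0 < N)%N -> small N P ->
  retr_g (glead (wG (wS N)) (sub mapg P)) != 0 -> retr_X (glead w P) != 0.
Proof.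
move=> wokw lt12 killP dP N0 smallP H; apply/negP => /eqP/retr_XP[U E].
have [_ EL] := glead_G (wok_S N0) H.
have L0 : lead_g (glead (wG (wS N)) (sub mapg P)) != 0 by rewrite lead_g_eq0.
have := L0; rewrite -EL => /cf_neq0[a' [s [t ast]]].
have a'0 : a' = 0%N.
  have := (gdegP (1, 0, 0) (glead (wS N) P) 0).1; rewrite {1}EL gdeg_lead_g.
  by move=> /(_ isT _ _ _ ast); rewrite /wdot /=; lia.
move: ast; rewrite {}a'0 cf_glead; case: ifP => [/eqP dS Pst|_]; last by rewrite eqxx.
have F0 : glead w P != 0 by rewrite glead_eq0; apply: contraTneq dP => ->; rewrite gdeg0.
have [a [b [a0]]] := lnd_cubic_monomial F0 E (lnd_kills_lead dP killP).
rewrite cf_glead; case: ifP => [/eqP dw Pab|_]; last by rewrite eqxx.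
have st := smallP _ _ _ Pst.
have := (gdegP (wS N) P _).1 (leqnn _) _ _ _ Pab.
have := (gdegP w P _).1 (leqnn _) _ _ _ Pst.
rewrite -dS -dw /wdot /wS /= => h1 h2.
(* Otherwise the weights (N, N+1, 1) would make x1^a x2^b heavier than the leading monomial x2^s
   x3^t, since s + t < N. *)
have le : (a + b <= s)%N by rewrite leqNgt; apply/negP => lt; nia.
by move: h1 lt12 a0 le; clear; nia.
Qed.

Lemma coprimary_g m P Q : coprimary P Q ->
  coprimary (iter m (sub mapg) P) (iter m (sub mapg) Q).
Proof. by move=> H; elim: m => //= m; apply: coprimary_sub (inv_g M). Qed.

Lemma coprimary_gdeg w P Q : wok w -> coprimary P Q -> (0 < gdeg w P)%N.
Proof.
move=> /and4P[w1 w2 w3 _] PQ; apply: gdeg_gt0 => // x.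
exact: coprimary_nonconst PQ.
Qed.

(** Membership in k[x3], the polynomials in the component that g fixes. *)
Definition axial P := sub (0, 0, x3) P == P.

Lemma axial_sub (B : R * R * R) P : B.2 = x3 -> axial P -> sub B P = P.
Proof.
move=> B3 /eqP; move=> <-; rewrite sub_comp /pcomp /= !rmorph0 subX B3 //.
Qed.

Lemma axial_g m P : axial (iter m (sub mapg) P) -> axial P.
Proof.
elim: m => //= m IH H; apply: IH.
have := axial_sub (B := mapG M) erefl H.
by rewrite (sub_inv _ (is_invC (inv_g M))) => ->.
Qed.

Lemma not_axial_monomial P : ~~ axial P -> exists a b c, (0 < a + b)%N /\ cf P a b c != 0.
Proof.
rewrite /axial -subr_eq0 => /cf_neq0[a [b [c H]]]; exists a, b, c.
move: H; have -> : sub (0, 0, x3) P - P = sub (0, 0, x3) P + cst (-1) * P.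
  by rewrite rmorphN rmorph1 mulN1r.
have cfC Q : cf (cst (-1) * Q) a b c = - cf Q a b c.
  apply/eqP; rewrite -addr_eq0 -cfD -{2}[Q]mul1r -mulrDl rmorphN rmorph1 addNr mul0r.
  by rewrite cf0.
rewrite cfD cfC cf_sub_axis; case: ifP => [/andP[/eqP-> /eqP->]|ab].
  by rewrite subrr eqxx.
by rewrite add0r oppr_eq0 => ->; split=> //; move: ab; lia.
Qed.

(** No cancellation through r factors g, for weights that start afresh at [wS N] on [P], whatever
    composition produced [P]. *)
Definition fine N r P := retr_g (glead (iter r wG (wS N)) (iter r (sub mapg) P)) != 0.

Lemma fine_le N r r' P : (0 < N)%N -> (r <= r')%N -> fine N r' P -> fine N r P.
Proof. by move=> N0; apply: retr_g_iter; apply: wok_S. Qed.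

(** A monomial of Q o g^r involving x1 or x2 outweighs all its pure powers of x3, which have
    exponent below [N]. Its leading form, an image under [lead_g], is then divisible by x2, and this
    forbids x2 - x1 x3 for P o g^r. *)
Lemma fine_lip N r P Q : (0 < N)%N -> coprimary P Q -> ~~ axial Q ->
  small N (iter r (sub mapg) Q) -> fine N r.+1 Q -> fine N r P.
Proof.
move=> N0 PQ axQ smQ H; apply/negP => /eqP/retr_gP[U EP].
have wokr := wok_iterG r (wok_S N0).
have {PQ} PQ := coprimary_g r PQ.
have dQ := coprimary_gdeg wokr (coprimary_sym PQ).
have dP := coprimary_gdeg wokr PQ.
have {axQ} : ~~ axial (iter r (sub mapg) Q) by apply: contra axQ; apply: axial_g.
set Qr := iter r _ Q in smQ PQ dQ *; set Pr := iter r _ P in PQ dP EP.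
set w := iter r wG (wS N) in wokr dQ dP EP *.
move=> /not_axial_monomial[a [b [c [ab Qabc]]]].
have [_ E] : _ /\ glead w Qr = lead_g (glead (wG w) (sub mapg Qr)) := glead_G wokr H.
have Q2 : sub (x1, 0, x3) (glead w Qr) = 0.
  have -> : sub (x1, 0, x3) (glead w Qr) = sub (0, 0, x3) (glead w Qr).
    rewrite E; move: (glead (wG w) _) => Y.
    by rewrite /= !sub_comp /pcomp /= !(rmorphM, subX) /= !mul0r.
  apply: cfP => a' b' c'; rewrite cf_sub_axis cf0; case: ifP => // _.
  rewrite cf_glead; case: eqP => // Ed; apply/eqP/negPn/negP => /smQ.
  have := (gdegP w Qr _).1 (leqnn _) _ _ _ Qabc.
  by rewrite -Ed /w iter_wG_S /wdot /=; move: ab; clear; nia.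
have [V EQ] := x2_factor Q2.
apply: (lnd_kills_L2 char0 _ _ _ EP EQ).
- exact: lnd_kills_lead dP (coprimary_lnd PQ).
- by rewrite glead_eq0; apply: contraTneq dP => ->; rewrite gdeg0.
- by rewrite glead_eq0; apply: contraTneq dQ => ->; rewrite gdeg0.
Qed.

Section Iterate.
Variable n : nat.
Hypothesis n3 : (2 < n)%N.

(* Composition with f = g^n h; its inverse [Top] is composition with [tfinv n]. *)
Definition Sop P : R := sub maph (iter n (sub mapg) P).
Definition wR w := wh (iter n wG w).

Lemma wokR w : wok w -> wok (wR w).
Proof.
rewrite /wR; case: n n3 => // r _ H; rewrite iter_wG.
by move: H; rewrite /wok /wh /=; lia.
Qed.

Lemma wok_iterR w m : wok w -> wok (iter m wR w).
Proof. by move=> H; elim: m => //= m; apply: wokR. Qed.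


Lemma coprimary_S m P Q : coprimary P Q -> coprimary (iter m Sop P) (iter m Sop Q).
Proof.
move=> H; elim: m => //= m IH.
by apply: coprimary_sub (inv_h M) _; apply: coprimary_g.
Qed.

(** The condition on x2 - x1 x3 seen after h; in contrast with [fine], the weights are arbitrary and
    can be transported along f. *)
Definition good w P := retr_X (glead w P) != 0.

Lemma goodS w P : good (wR w) (Sop P) = (retr_g (glead (iter n wG w) (iter n (sub mapg) P)) != 0).
Proof. by rewrite /good /wR /Sop retr_X_glead_h. Qed.

Lemma glead_iter_G w P m : wok w ->
  retr_g (glead (iter m wG w) (iter m (sub mapg) P)) != 0 ->
  gdeg w P = gdeg (iter m wG w) (iter m (sub mapg) P) /\
  glead w P = iter m lead_g (glead (iter m wG w) (iter m (sub mapg) P)).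
Proof.
move=> wokw; elim: m => // m IH H.
have [H' _] := retr_g_G (wok_iterG m wokw) H.
have [-> ->] := IH H'; have [-> ->] := glead_G (wok_iterG m wokw) H.
by rewrite -iterSr.
Qed.

(** Two applications of [lead_g] send x1 and x2 to x2 x3 and x2 x3^2, so a form without constant
    term becomes divisible by x3, which forbids x3 - x1 x2 for [P]. *)
Lemma good_lip w P Q : wok w -> coprimary P Q -> good (wR w) (Sop Q) -> good w P.
Proof.
move=> wokw PQ; rewrite goodS => H; apply/negP => /eqP/retr_XP[U EP].
have dQ := coprimary_gdeg wokw (coprimary_sym PQ).
have dP := coprimary_gdeg wokw PQ.
have H2 := retr_g_iter (m := 2) wokw (ltnW n3) H.
have [d2 E2] := glead_iter_G wokw H2.
have Q3 : sub (x1, x2, 0) (glead w Q) = 0.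
  have Y0 : sub (0, 0, 0) (glead (iter 2 wG w) (iter 2 (sub mapg) Q)) = 0.
    by rewrite sub_origin_glead // -d2.
  rewrite E2; move: (glead _ _) Y0 => Y Y0.
  by rewrite /= !sub_comp /pcomp /= !(rmorphM, subX) /= !(mulr0, subX) /=.
have [V EQ] := x3_factor Q3.
apply: (lnd_kills_L1 char0 _ _ _ EP EQ).
- exact: lnd_kills_lead dP (coprimary_lnd PQ).
- by rewrite glead_eq0; apply: contraTneq dP => ->; rewrite gdeg0.
- by rewrite glead_eq0; apply: contraTneq dQ => ->; rewrite gdeg0.
Qed.

End Iterate.
End Chains.

(** * Counting in a table of truth values *)

Section Counting.

(** Otherwise [u] would gain at least one on each of the [J] blocks of length five. *)
Lemma flat_block (u : nat -> nat) J B :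
  (forall l, (l < 5 * J)%N -> (u l <= u l.+1)%N) -> (u (5 * J) <= B)%N -> (B < J)%N ->
  exists2 j, (j < J)%N & u (5 * j)%N = u (5 * j + 5)%N.
Proof.
move=> mono uB BJ.
have [/existsP[j /eqP E]|] := boolP [exists j : 'I_J, u (5 * j)%N == u (5 * j + 5)%N].
  by exists j.
rewrite negb_exists => /forallP strict.
suff : forall j, (j <= J)%N -> (j <= u (5 * j))%N by move=> /(_ J (leqnn _)); lia.
elim=> // j IH lt; have := IH (ltnW lt).
have := strict (Ordinal lt); rewrite /= => /eqP ne.
have m0 d : (d < 5)%N -> (u (5 * j + d) <= u (5 * j + d.+1))%N.
  by move=> d5; rewrite addnS; apply: mono; lia.
have := m0 0%N isT; have := m0 1%N isT; have := m0 2%N isT; have := m0 3%N isT.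
have := m0 4%N isT.
rewrite addn0 mulnS [(5 + _)%N]addnC; move: ne; lia.
Qed.

(** Rows count applications of f, columns the components q_l; [b] will be [fine N 1] and [a] will be
    [axial]. *)
Variables (b a : nat -> nat -> bool) (C kk : nat).
Hypothesis b_down : forall i l, (i < kk)%N -> (l <= kk)%N -> b i.+1 l -> b i l.
Hypothesis b_diag : forall i l, (i < kk)%N -> (l < kk)%N -> b i.+1 l.+1 -> b i l.
Hypothesis b_diag2 : forall i l, (i < kk)%N -> (l.+1 < kk)%N -> b i.+1 l.+2 ->
  a i l.+1 || b i l.
Hypothesis b_start : ~~ b C.+2 0.
Hypothesis b_end : b (kk - C.+1) kk.
Hypothesis kk_large : (5 * (2 * C + 3) <= kk)%N.

(** The first failing row of column [l], with default [kk.+1] if no row up to [kk] fails. *)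
Let s l := find (fun i => ~~ b i l) (iota 0 kk.+1).

Let s_le l : (s l <= kk.+1)%N.
Proof. by rewrite /s -[X in (_ <= X)%N](size_iota 0) find_size. Qed.

Let before_s l i : (i < s l)%N -> b i l.
Proof.
move=> H; have := before_find 0 H; rewrite nth_iota; last by apply: leq_trans H (s_le l).
by move/negbFE.
Qed.

Let at_s l : (s l <= kk)%N -> ~~ b (s l) l.
Proof.
move=> H; have := @nth_find _ 0 (fun i => ~~ b i l) (iota 0 kk.+1).
by rewrite has_find size_iota ltnS => /(_ H); rewrite nth_iota.
Qed.

Let s_gt l i : (i <= kk)%N -> (l <= kk)%N -> b i l -> (i < s l)%N.
Proof.
move=> ik lk bil; rewrite ltnNge; apply/negP => H.
have /negP[] := at_s (leq_trans H ik).
rewrite -(subnK H) in ik bil; elim: (i - s l)%N ik bil => // d IH ik.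
by rewrite addSn => /(b_down ik lk); apply: IH; apply: ltnW.
Qed.

Let s_step l : (l < kk)%N -> (s l.+1 <= (s l).+1)%N.
Proof.
move=> lk; rewrite leqNgt; apply/negP => H.
have sk : (s l < kk)%N by have := s_le l.+1; lia.
by have := b_diag sk lk (before_s H); apply/negP/at_s; apply: ltnW.
Qed.

Lemma diagonal_run : exists i l, [/\ (i + 3 <= kk)%N, (l + 3 <= kk)%N &
  forall t, (t < 4)%N -> a (i + t) (l + t)].
Proof.
(* The defect of [s] against slope one. The offset [C.+2] bounds [s 0] and prevents truncation; as
   [s kk] exceeds [kk - C.+1], the final defect is at most [2 * C + 2], whence [2 * C + 3]
   blocks. *)
pose u l := (l + C.+2 - s l)%N.
have s0 : (s 0 <= C.+2)%N.
  by rewrite leqNgt; apply/negP => /before_s; apply/negP.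
have send : (kk - C.+1 < s kk)%N by apply: s_gt => //; apply: leq_subr.
have sl l : (l <= kk)%N -> (s l <= l + C.+2)%N.
  by elim: l => // l IH lk; have := s_step lk; have := IH (ltnW lk); lia.
have mono l : (l < kk)%N -> (u l <= u l.+1)%N.
  by move=> lk; have := s_step lk; rewrite /u; lia.
have mono2 l d : (l + d <= kk)%N -> (u l <= u (l + d))%N.
  elim: d => [|d IH]; first by rewrite addn0.
  by rewrite addnS => H; apply: leq_trans (IH (ltnW H)) (mono _ H).
have uend : (u (5 * (2 * C + 3)) <= 2 * C + 2)%N.
  have := mono2 _ _ (eq_leq (subnKC kk_large)); rewrite subnKC // => H.
  by apply: leq_trans H _; rewrite /u; lia.
have monoJ l : (l < 5 * (2 * C + 3))%N -> (u l <= u l.+1)%N.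
  by move=> lk; apply: mono; apply: leq_trans kk_large.
have [j jJ E] := flat_block monoJ uend (ltac:(lia) : (2 * C + 2 < 2 * C + 3)%N).
set l := (5 * j)%N in E.
have lk : (l + 5 <= kk)%N by rewrite /l; lia.
have st t : (t <= 5)%N -> s (l + t)%N = (s l + t)%N.
  move=> t5; have e1 : (u l <= u (l + t))%N by apply: mono2; lia.
  have e2 : (u (l + t) <= u (l + 5))%N.
    have -> : (l + 5 = l + t + (5 - t))%N by lia.
    by apply: mono2; lia.
  have := sl l; have := sl (l + t)%N; move: e1 e2; rewrite -E /u; lia.
have s5 := st 5%N (leqnn _); have sk := s_le (l + 5)%N.
(* [b_diag2] spans two columns, so five unit steps serve the four values with [t.+2 <= 5]; it puts
   [a] in the middle column, hence the shift to [l.+1]. *)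
exists (s l), l.+1; split; [lia|lia|] => t t4.
have [t5 t5'] : (t.+2 <= 5)%N /\ (t <= 5)%N by lia.
have st2 := st _ t5; have st0 := st _ t5'.
have h1 : (s l + t < kk)%N by lia.
have h2 : ((l + t).+1 < kk)%N by lia.
have h3 : b (s l + t).+1 (l + t).+2 by apply: before_s; rewrite -!addnS st2 !addnS.
rewrite addSn; have /orP[//|B] := b_diag2 h1 h2 h3.
by have /negP[] : ~~ b (s (l + t)%N) (l + t); [apply: at_s; lia | rewrite st0].
Qed.

End Counting.

(** * From orbit segments with nearby ends to components in k[x3] *)

Section Alignment.
Variables (k : fieldType) (M : pol3 k).
Hypothesis char0 : [pchar k] =i pred0.
Local Notation R := (pol M).
Local Notation x1 := (px1 M).
Local Notation x2 := (px2 M).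
Local Notation x3 := (px3 M).
Local Notation cst := (pcst M).
Local Notation retr_g := (retr_g M).
Local Notation retr_X := (retr_X M).
Local Notation lead_g := (lead_g M).
Local Notation mapg := (mapg M).
Local Notation maph := (maph M).
Implicit Types (P Q H : R) (w : nat * nat * nat) (N m r : nat).
Variable n : nat.
Hypothesis n3 : (2 < n)%N.
Local Notation Sop := (@Sop k M n).
Local Notation wR := (wR n).

Definition Top P : R := iter n (sub (mapG M)) (sub (maphV M) P).

Lemma SopK P : Sop (Top P) = P.
Proof.
rewrite /Sop /Top; elim: (n) => [|m IH]; first exact: sub_inv (inv_h M).
by rewrite iterSr iterS (sub_inv _ (inv_g M)).
Qed.

Lemma TopK P : Top (Sop P) = P.
Proof.
rewrite /Sop /Top (sub_inv _ (is_invC (inv_h M))).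
elim: (n) => // m IH.
by rewrite iterSr iterS (sub_inv _ (is_invC (inv_g M))).
Qed.

Lemma wR_lt w : wok w -> ((wR w).1.1 < (wR w).1.2)%N.
Proof.
rewrite /wR; case: n n3 => [|[|m]] // _; rewrite iter_wG /wok /wh /=; nia.
Qed.

Lemma Sop_x3 : Sop x3 = x1.
Proof.
rewrite /Sop; have -> : iter n (sub mapg) x3 = x3.
  by elim: (n) => //= m ->; rewrite subX.
by rewrite subX.
Qed.

(** x1 o g is the divisor x2 - x1 x3 itself; if it survived, the leading form x1 would be an image
    under [lead_g], hence free of x1. *)
Lemma retr_g_delta w : wok w -> retr_g (glead (wG w) (sub mapg x1)) = 0.
Proof.
move=> wokw; apply/eqP/negPn/negP => H; have [_ E] := glead_G wokw H.
have := gdeg_lead_g (glead (wG w) (sub mapg x1)).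
by rewrite -E glead_X1 gdeg_X1.
Qed.

(** One f turns x3 into x1, and the first g of the next f turns x1 into the forbidden divisor,
    whereas x3 itself is good for all weights. *)
Lemma not_good2_x3 w : wok w -> ~~ good (wR (wR w)) (Sop (Sop x3)).
Proof.
move=> wokw; rewrite Sop_x3 goodS; apply/negP => H.
have wokRw := wokR n3 wokw.
have := retr_g_iter (m := 1) wokRw (ltnW (ltnW n3)) H.
by rewrite /= retr_g_delta // eqxx.
Qed.

Lemma good_x3 w : good w x3.
Proof.
by rewrite /good glead_X3 subX /= mulf_neq0 ?px1_neq0 ?px2_neq0.
Qed.

Lemma glead_cstD w x P : (0 < gdeg w P)%N -> glead w (cst x + P) = glead w P.
Proof.
move=> P0; have d : gdeg w (cst x + P) = gdeg w P.
  apply/eqP; rewrite eqn_leq gdegD_le ?gdeg_cst //= leqNgt; apply/negP => lt.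
  have E : P = cst x + P + cst (- x) by rewrite rmorphN; ring.
  have : (gdeg w P <= (gdeg w P).-1)%N.
    have lt' : (gdeg w (cst x + P) <= (gdeg w P).-1)%N by rewrite -ltnS prednK.
    have := @gdegD_le _ M w _ (cst (- x)) _ lt'.
    by rewrite -E gdeg_cst; apply.
  by move: P0; lia.
by rewrite !gleadE d gcompD gcomp_small ?gdeg_cst // add0r.
Qed.

(** Since x3 o f o g = x2 - x1 x3, the polynomial P o f o g is a constant plus a multiple of the
    forbidden divisor. *)
Lemma axial_not_fine N P : (0 < N)%N -> (forall x, P <> cst x) -> axial P ->
  ~~ fine N 1 (Sop P).
Proof.
move=> N0 Pc axP.
have wokS := wok_S N0.
have ES : sub mapg (Sop P) = sub (0, 0, sub mapg x1) P.
  rewrite /Sop; have -> : iter n (sub mapg) P = P.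
    by elim: (n) => //= m ->; apply: axial_sub.
  by rewrite -{1}(eqP axP) !sub_comp /pcomp /= !rmorph0 !subX.
have [U EU] : exists U, sub (0, 0, sub mapg x1) P - sub (0, 0, 0) P = U * sub mapg x1.
  apply: sub_congr => /=; try by exists 0; rewrite subrr mul0r.
  by exists 1; rewrite mul1r subr0.
have {}EU : sub mapg (Sop P) = cst (cf P 0 0 0) + U * sub mapg x1.
  by rewrite ES -EU sub_origin; ring.
have Uc : U * sub mapg x1 != 0.
  apply/negP => /eqP U0; rewrite U0 addr0 in EU.
  case: (Pc (cf P 0 0 0)); rewrite -[LHS](TopK P) /Top.
  have -> : Sop P = cst (cf P 0 0 0).
    by rewrite -[LHS](sub_inv _ (is_invC (inv_g M))) EU sub_cst.
  by rewrite sub_cst; elim: (n) => //= m ->; rewrite sub_cst.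
rewrite /fine /= EU negbK.
have dU : (0 < gdeg (wG (wS N)) (U * sub mapg x1))%N.
  have [U0 d0] : U != 0 /\ sub mapg x1 != 0 by apply/andP; rewrite -negb_or -mulf_eq0.
  rewrite gdegM // addn_gt0; apply/orP; right; apply: gdeg_gt0 => // x /(congr1 (sub (mapG M))).
  rewrite (sub_inv _ (is_invC (inv_g M))) sub_cst => E.
  by have := gdeg_X1 M (1, 0, 0)%N; rewrite E gdeg_cst.
by rewrite glead_cstD // gleadM rmorphM retr_g_delta // mulr0.
Qed.

Fixpoint reach m P Q : Prop :=
  if m is m'.+1 then exists U, coprimary P U /\ reach m' U Q else P = Q.

Lemma reach_S i m P Q : reach m P Q -> reach m (iter i Sop P) (iter i Sop Q).
Proof.
elim: m P => [|m IH] P /=; first by move->.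
by move=> [U [PU UQ]]; exists (iter i Sop U); split; [apply: coprimary_S|apply: IH].
Qed.

(** By [good_lip] each link of the chain costs one application of f. *)
Lemma good_reachl w m r P Q : wok w -> reach m P Q ->
  good (iter (m + r) wR w) (iter (m + r) Sop P) -> good (iter r wR w) (iter r Sop Q).
Proof.
move=> wokw; elim: m P => [|m IH] P /=; first by move->.
move=> [U [PU UQ]] H; apply: IH UQ _.
have := coprimary_S n (m + r) (coprimary_sym PU) => UP.
exact: good_lip (wok_iterR n3 _ wokw) UP H.
Qed.

Lemma good_reachr w m r P Q : wok w -> reach m P Q ->
  good (iter (m + r) wR w) (iter (m + r) Sop Q) -> good (iter r wR w) (iter r Sop P).
Proof.
move=> wokw; elim: m r P => [|m IH] r P /=; first by move->.
move=> [U [PU UQ]]; rewrite -[_ (iter _ _ w)]/(iter (m + r).+1 wR w) -iterS -addnS => H.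
have := IH r.+1 U UQ H => /=.
by apply: good_lip (wok_iterR n3 _ wokw) (coprimary_S n r PU).
Qed.

Lemma small_bound (I : finType) (F : I -> R) : exists2 N, (0 < N)%N & forall i, small N (F i).
Proof.
exists (\max_i gdeg (1, 1, 1)%N (F i)).+1 => // i a b c H; rewrite ltnS.
apply: leq_trans (leq_bigmax i).
by have := (gdegP _ _ _).1 (leqnn (gdeg (1, 1, 1)%N (F i))) _ _ _ H; rewrite /wdot /= !mul1n.
Qed.

Section Orbit.
Variables (q : nat -> R) (C kk : nat).
Hypothesis q_step : forall l, coprimary (q l) (q l.+1).
Hypothesis q_start : reach C x3 (q 0).
Hypothesis q_end : reach C (iter kk Top x3) (q kk).
Hypothesis kk_large : (5 * (2 * C + 3) <= kk)%N.

Theorem axial_run : exists i l, [/\ (i + 3 <= kk)%N, (l + 3 <= kk)%N &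
  forall t, (t < 4)%N -> axial (iter (i + t) Sop (q (l + t)))].
Proof.
(* [N] is chosen after the orbit, above the total degree of the finitely many polynomials to which
   [small] is applied. *)
have [N N0 smallN] := small_bound (fun x : 'I_n.+1 * 'I_kk.+1 * 'I_kk.+1 =>
   iter x.1.1 (sub mapg) (iter x.1.2 Sop (q x.2))).
have {}smallN r i l : (r <= n)%N -> (i <= kk)%N -> (l <= kk)%N ->
    small N (iter r (sub mapg) (iter i Sop (q l))).
  move=> Hr Hi Hl.
  exact: (smallN (Ordinal (Hr : (r < n.+1)%N), Ordinal (Hi : (i < kk.+1)%N),
                  Ordinal (Hl : (l < kk.+1)%N))).
have wokS := wok_S N0.
have qS i l : coprimary (iter i Sop (q l)) (iter i Sop (q l.+1)) by apply: coprimary_S.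
have barrier i l w : (i <= kk)%N -> (l <= kk)%N -> wok w -> (w.1.1 < w.1.2)%N ->
    fine N 1 (iter i Sop (q l)) -> good w (iter i Sop (q l)).
  move=> ik lk wokw w12; apply: left_barrier => //.
  - exact: coprimary_lnd (coprimaryl (qS i l)).
  - exact: coprimary_gdeg wokw (qS i l).
  - exact: (smallN 0).
(* Restarting the weights: surviving one g for [wS N] after an f gives, by the barrier, goodness for
   the transported weights [wR (wS N)], which says that all n factors g of that f were survived. *)
have fine_n i l : (i < kk)%N -> (l <= kk)%N -> fine N 1 (iter i.+1 Sop (q l)) ->
    fine N n (iter i Sop (q l)).
  move=> ik lk /(barrier _ _ _ ik lk (wokR n3 wokS) (wR_lt wokS)).
  by rewrite iterS goodS.
have notax i l : (0 < l)%N -> fine N 1 (iter i.+1 Sop (q l)) -> ~~ axial (iter i Sop (q l)).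
  case: l => // l _; apply: contraL => /axial_not_fine; apply=> // x.
  exact: coprimary_nonconst (coprimary_sym (qS i l)).
apply: (@diagonal_run (fun i l => fine N 1 (iter i Sop (q l)))
  (fun i l => axial (iter i Sop (q l))) C kk) => //.
- by move=> i l ik lk /fine_n-/(_ ik lk); apply: fine_le => //; lia.
- move=> i l ik lk H; have Hn := fine_n _ _ ik lk H.
  have ax := notax _ _ (ltn0Sn l) H.
  have n1 : (0 < n.-1)%N by lia.
  have n1n : (n.-1 <= n)%N by lia.
  apply: (fine_le N0 n1); apply: (fine_lip char0 N0 (qS i l) ax).
    by apply: smallN => //; apply: ltnW.
  by rewrite prednK //; lia.
(* Two changes of column fit into the n factors g of a single f, as [n - 2] is still at least 1. *)
- move=> i l ik lk H; have [//|ax1] := boolP (axial _).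
  have Hn := fine_n _ _ ik lk H.
  have ax := notax _ _ (ltn0Sn l.+1) H.
  have [n2 n2n n2n'] : [/\ 0 < n - 2, n - 2 <= n & (n - 2).+1 <= n]%N by split; lia.
  apply: (fine_le N0 n2); apply: (fine_lip char0 N0 (qS i l) ax1).
    by apply: smallN => //; apply: ltnW => //; apply: ltnW.
  apply: (fine_lip char0 N0 (qS i l.+1) ax); first by apply: smallN => //; apply: ltnW.
  by have -> : (n - 2).+2 = n by lia.
(* The C links back to x3 use C of the [C.+2] applications of f; the two that remain contradict
   [not_good2_x3]. *)
- apply/negP => H.
  have Ck : (C.+2 <= kk)%N by lia.
  have wlt : ((iter C.+2 wR (wS N)).1.1 < (iter C.+2 wR (wS N)).1.2)%N.
    exact: wR_lt (wok_iterR n3 C.+1 wokS).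
  have := barrier _ _ _ Ck (leq0n kk) (wok_iterR n3 C.+2 wokS) wlt H.
  rewrite -addn2 => /(good_reachr wokS q_start).
  by apply/negP; apply: not_good2_x3.
(* With weights [wS N] in this row, [C.+1] applications of f lead to x3, which is good; the links
   use C of them and the last one is spent in [goodS]. *)
- pose i := (kk - C.+1)%N.
  have reachi := reach_S i q_end.
  have iT d : iter d Sop (iter d Top x3) = x3.
    by elim: d => // d IH; rewrite iterSr iterS SopK.
  have : good (iter (C + 1) wR (wS N)) (iter (C + 1) Sop (iter i Sop (iter kk Top x3))).
    rewrite -iterD; have -> : (C + 1 + i = kk)%N by rewrite /i; lia.
    by rewrite iT good_x3.
  move=> /(good_reachl wokS reachi) /=; rewrite goodS; apply: fine_le => //; lia.
Qed.

End Orbit.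
End Alignment.

(** * Fibonacci polynomials and rigidity *)

Section Rigidity.
Variables (k : fieldType) (M : pol3 k).
Local Notation R := (pol M).
Local Notation x1 := (px1 M).
Local Notation x2 := (px2 M).
Local Notation x3 := (px3 M).
Local Notation cst := (pcst M).
Local Notation mapg := (mapg M).
Local Notation mapG := (mapG M).
Local Notation maph := (maph M).
Implicit Types (P Q y : R) (u : {poly k}).
Local Notation "u ^f" := (map_poly cst u) : ring_scope.

Lemma sub_horner A u y : sub A u^f.[y] = u^f.[sub A y].
Proof.
rewrite -horner_map /= -map_poly_comp; congr (_.[_]).
by apply: eq_map_poly => x /=; rewrite sub_cst.
Qed.

Lemma axial_horner P : axial P -> exists u, forall B, sub B P = u^f.[B.2].
Proof.
move=> /eqP axP; suff [u Eu] : exists u, forall y, sub (0, 0, y) P = u^f.[y].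
  by exists u => B; rewrite -{1}axP Eu sub_horner sub_X3.
move: {axP} P; apply: mon_ind => [|P Q [u Eu] [v Ev]|x a b c].
- by exists 0 => y; rewrite rmorph0 rmorph0 horner0.
- by exists (u + v) => y; rewrite !rmorphD /= hornerD Eu Ev.
exists ((x * 0 ^+ a * 0 ^+ b)%:P * 'X^c) => y.
have -> : ((x * 0 ^+ a * 0 ^+ b)%:P * 'X^c)^f = (cst (x * 0 ^+ a * 0 ^+ b))%:P * 'X^c.
  by rewrite (rmorphM (map_poly cst)) /= map_polyC map_polyXn.
rewrite hornerM hornerC hornerXn (rmorphM cst) (rmorphM cst) !(rmorphXn cst) rmorph0.
by rewrite !(rmorphM (sub _)) !(rmorphXn (sub _)) !subX.
Qed.

(** After grading this is a composition of univariate polynomials over a domain, where degrees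
    multiply. *)
Lemma horner_degree1 w P u y : gdeg w P = 1%N -> P = u^f.[y] -> size u = 2.
Proof.
move=> dP E; have EP : grade M w P = (u^f)^:P.[grade M w y].
  rewrite E -horner_map /= -map_poly_comp -[RHS]/(_.[_]); congr (_.[_]).
  rewrite -map_poly_comp; apply: eq_map_poly => x /=; exact: grade_cst.
have : (size (grade M w P)).-1 = 1%N by rewrite -gdegE.
rewrite EP -[_.[_]]/(u^f \Po grade M w y) size_comp_poly size_map_poly => /eqP.
by rewrite muln_eq1 => /andP[/eqP]; case: (size u) => [|[|[]]].
Qed.

Lemma size2_poly u : size u = 2 -> u = u`_1 *: 'X + (u`_0)%:P /\ u`_1 != 0.
Proof.
move=> su; split; last first.
  by have := lead_coefE u; rewrite su /= => <-; rewrite lead_coef_eq0 -size_poly_eq0 su.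
apply/polyP => i; rewrite coefD coefZ coefX coefC.
by case: i => [|[|i]] /=; rewrite ?mulr0 ?mulr1 ?add0r ?addr0 // nth_default // su.
Qed.

Lemma size_affine (g h : k) : g != 0 -> size (g *: 'X + h%:P) = 2.
Proof.
by move=> g0; rewrite -mul_polyC size_MXaddC polyC_eq0 (negPf g0) size_polyC g0.
Qed.

Lemma horner_size2 u y : size u = 2 -> u^f.[y] = cst u`_1 * y + cst u`_0.
Proof.
move=> /size2_poly[E _]; rewrite {1}E (rmorphD (map_poly cst)) /=.
by rewrite map_polyZ map_polyX map_polyC !hornerE.
Qed.

(** The Fibonacci polynomials; the index equals the size, so K m has degree m - 1 for positive m. *)
Fixpoint continuant (m : nat) : {poly k} :=
  if m is m'.+1 then
    if m' is m''.+1 then continuant m'' + continuant m' * 'X else 1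
  else 0.
Local Notation K := continuant.
Arguments continuant : simpl never.

Lemma continuant0 : K 0 = 0. Proof. by []. Qed.
Lemma continuant1 : K 1 = 1. Proof. by []. Qed.

Lemma continuantSS m : K m.+2 = K m + K m.+1 * 'X.
Proof. by []. Qed.

Lemma size_continuant m : size (K m) = m.
Proof.
suff : size (K m) = m /\ size (K m.+1) = m.+1 by case.
elim: m => [|m [IH IH1]]; first by rewrite size_poly0 size_poly1.
split=> //; rewrite continuantSS addrC size_polyDl size_mulX -?size_poly_eq0 IH1 //.
by rewrite IH.
Qed.

Lemma lead_coef_continuant m : lead_coef (K m.+1) = 1.
Proof.
elim: m => [|m IH]; first exact: lead_coef1.
rewrite continuantSS addrC lead_coefDl ?lead_coefMX //.
by rewrite size_mulX -?size_poly_eq0 !size_continuant.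
Qed.

Lemma continuant_eq0 m : (K m == 0) = (m == 0%N).
Proof. by rewrite -size_poly_eq0 size_continuant. Qed.

Lemma iter_G_x2 m :
  iter m (sub mapG) x2 = x2 * (K m.+1)^f.[x3] + x1 * (K m)^f.[x3].
Proof.
have Gx3 p : iter p (sub mapG) x3 = x3 by elim: p => //= p ->; rewrite subX.
have iD p P Q : iter p (sub mapG) (P + Q) = iter p (sub mapG) P + iter p (sub mapG) Q.
  by elim: p => //= p ->; rewrite rmorphD.
have iM p P Q : iter p (sub mapG) (P * Q) = iter p (sub mapG) P * iter p (sub mapG) Q.
  by elim: p => //= p ->; rewrite rmorphM.
have G2 p : iter p.+2 (sub mapG) x2 = iter p (sub mapG) x2 + iter p.+1 (sub mapG) x2 * x3.
  rewrite !iterSr -[X in _ * X](Gx3 p) -iM -iD; congr (iter _ _ _).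
  by rewrite sub_X2 /= rmorphD rmorphM !subX /=.
suff : iter m (sub mapG) x2 = x2 * (K m.+1)^f.[x3] + x1 * (K m)^f.[x3] /\
  iter m.+1 (sub mapG) x2 = x2 * (K m.+2)^f.[x3] + x1 * (K m.+1)^f.[x3] by case.
elim: m => [|m [IH IH1]]; split=> //.
- by rewrite /= continuant0 continuant1 rmorph0 rmorph1 horner0 hornerC; ring.
- rewrite /= subX continuantSS continuant0 continuant1 add0r mul1r map_polyX rmorph1.
  by rewrite hornerX hornerC /=; ring.
have Kh q : (K q.+2)^f.[x3] = (K q)^f.[x3] + (K q.+1)^f.[x3] * x3.
  by rewrite continuantSS rmorphD rmorphM /= map_polyX !hornerE.
by rewrite G2 IH IH1 (Kh m.+1) (Kh m); ring.
Qed.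

(* Since K_(m+2) = K_m + X K_(m+1), comparing the coefficients of X^(m+1) and X^m
   forces the affine change of variable L to be a sign. *)
Lemma continuant_affine m (L : {poly k}) (g h mu nu : k) :
  L = g *: 'X + h%:P -> g != 0 -> nu != 0 ->
  K m.+3 \Po L = mu *: K m.+3 -> K m.+2 \Po L = nu *: K m.+2 ->
  [/\ h = 0, g ^+ 2 = 1 & mu = nu * g].
Proof.
move=> EL g0 nu0 Emu Enu.
have sL : size L = 2 by rewrite EL size_affine.
have E : K m.+1 \Po L =
    mu *: K m.+1 + (mu - nu * g) *: (K m.+2 * 'X) - (nu * h) *: K m.+2.
  move: Emu; rewrite (continuantSS m.+1) comp_polyD comp_polyM comp_polyX Enu EL.
  move=> /(canRL (addrK _)) ->; rewrite -!mul_polyC !(rmorphB, rmorphM, rmorphD) /=; ring.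
have s1 : (size (K m.+1 \Po L) <= m.+1)%N by rewrite size_comp_poly2 // size_continuant.
have c1 := congr1 (fun p : {poly k} => p`_m.+2) E.
have c2 := congr1 (fun p : {poly k} => p`_m.+1) E.
have top p : (K p.+1)`_p = 1.
  by have := lead_coef_continuant p; rewrite lead_coefE size_continuant.
have out p q : (p < q)%N -> (K p.+1)`_q = 0.
  by move=> pq; rewrite nth_default // size_continuant.
move: c1; rewrite nth_default ?(leq_trans s1) // !coefD coefN !coefZ coefMX /= top !out //.
rewrite !mulr0 mulr1 subr0 add0r => /esym/eqP; rewrite subr_eq0 => /eqP Emn.
move: c2; rewrite nth_default ?(leq_trans s1) // !coefD coefN !coefZ coefMX /= Emn subrr.
rewrite mul0r addr0 top out // mulr0 add0r mulr1 => /esym/eqP; rewrite oppr_eq0 mulf_eq0.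
rewrite (negPf nu0) /= => /eqP h0; split=> //.
have lc p : lead_coef (K p.+1 \Po L) = g ^+ p.
  rewrite lead_coef_comp ?sL // lead_coef_continuant size_continuant mul1r /=.
  by congr (_ ^+ _); rewrite lead_coefE sL /= EL coefD coefZ coefX coefC /= mulr1 addr0.
(* Leading coefficients give mu = g^m and nu = g^(m+1); with mu = nu g this yields g^2 = 1. *)
have E1 : mu = g ^+ m.
  rewrite -(lc m) E Emn subrr scale0r addr0 h0 mulr0 scale0r subr0 lead_coefZ.
  by rewrite lead_coef_continuant mulr1.
have E2 : nu = g ^+ m.+1 by rewrite -(lc m.+1) Enu lead_coefZ lead_coef_continuant mulr1.
apply: (mulfI (x := g ^+ m)); first by rewrite expf_neq0.
by rewrite mulr1 expr2 mulrA -exprSr -E2 -Emn E1.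
Qed.

Section Rigid.
Variable n : nat.
Hypothesis n3 : (2 < n)%N.
Local Notation Sop := (@Sop k M n).
Local Notation Top := (@Top k M n).

Lemma Top_x3 : Top x3 = x2 * (K n.+1)^f.[x3] + x1 * (K n)^f.[x3].
Proof. by rewrite /Top subX iter_G_x2. Qed.

(** The inputs concern three consecutive members x3 o f = x1, x3 and x3 o f^-1 of the orbit. Degrees
    make the [u]'s affine; the relation for [Top x3], specialized at (x1, x2) = (0,0), (0,1), (1,0),
    then compares Fibonacci polynomials with their composites with an affine [L]. *)
Lemma rigid A B u0 u1 u2 : is_inv A B ->
  A.1.1 = u0^f.[x1] -> A.2 = u1^f.[x3] -> sub A (Top x3) = u2^f.[Top x3] ->
  exists a g, [/\ g ^+ 2 = 1, a != 0 &
    A = (cst a * x1, cst (a * g) * x2, cst g * x3)].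
Proof.
move=> AB E1 E3 ET.
have s0 : size u0 = 2.
  apply: (@horner_degree1 (1, 1, 1)%N x1 _ (sub B x1)); first by rewrite gdeg_X1.
  by rewrite -[LHS](sub_inv _ (is_invC AB)) sub_X1 E1 sub_horner.
have s1 : size u1 = 2.
  apply: (@horner_degree1 (1, 1, 1)%N x3 _ (sub B x3)); first by rewrite gdeg_X3.
  by rewrite -[LHS](sub_inv _ (is_invC AB)) sub_X3 E3 sub_horner.
have Sop_horner u y : Sop u^f.[y] = u^f.[Sop y].
  have ih p : iter p (sub mapg) u^f.[y] = u^f.[iter p (sub mapg) y].
    by elim: p => //= p ->; rewrite sub_horner.
  by rewrite /Sop ih sub_horner.
have s2 : size u2 = 2.
  apply: (@horner_degree1 (1, 1, 1)%N x3 _ (Sop (sub B (Top x3)))).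
    by rewrite gdeg_X3.
  by rewrite -Sop_horner -sub_horner -ET (sub_inv _ (is_invC AB)) SopK.
have [_ a0] := size2_poly s0; have [_ g0] := size2_poly s1; have [_ c0] := size2_poly s2.
move: E1 E3 ET; rewrite !horner_size2 //.
move: (u0`_1) a0 (u0`_0) (u1`_1) g0 (u1`_0) (u2`_1) c0 (u2`_0) => a a0 b g g0 h c c0 d.
case: A {AB} => [[f1 f2] f3] /= -> -> {f1 f3}.
rewrite Top_x3 rmorphD !rmorphM !subX /= !sub_horner !subX /= => E.
pose L : {poly k} := g *: 'X + h%:P.
pose rho s t : {rmorphism R -> {poly k}} := ev_in M polyC s%:P t%:P 'X.
have rhoc s t x : rho s t (cst x) = x%:P by apply: ev_in_cst.
have rho1 s t : rho s t x1 = s%:P by apply: ev_in_X1.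
have rho2 s t : rho s t x2 = t%:P by apply: ev_in_X2.
have rho3 s t : rho s t x3 = 'X by apply: ev_in_X3.
have rhoh s t u y : rho s t u^f.[y] = u \Po rho s t y.
  rewrite -horner_map /= -map_poly_comp /comp_poly; congr (_.[_]).
  by apply: eq_map_poly => x /=.
have rhoL s t : rho s t (cst g * x3 + cst h) = L.
  by rewrite rmorphD rmorphM !rhoc rho3 mul_polyC.
have sL : size L = 2 by rewrite size_affine.
have sK p : size (K p \Po L) = p by rewrite size_comp_poly2 // size_continuant.
have eqE s t := congr1 (rho s t) E.
(* K n.+1 o L has size n + 1, too large to divide a nonzero polynomial of size at most n; this kills
   values of [f2]. *)
have small_mul (v r : {poly k}) : v * (K n.+1 \Po L) = r -> (size r <= n)%N -> v = 0.
  move=> <-; have [//|v0] := eqVneq v 0; rewrite size_mul //; last first.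
    by rewrite -size_poly_eq0 sK.
  rewrite sK addnS /= -[X in (_ <= X)%N]add0n leq_add2r leqn0 size_poly_eq0.
  by rewrite (negPf v0).
have H00 := eqE 0 0; have H01 := eqE 0 1; have H10 := eqE 1 0.
move: H00 H01 H10.
rewrite !(rmorphD (rho _ _), rmorphM (rho _ _)) !rhoh !rhoL !rhoc !rho1 !rho2 !rho3.
rewrite !comp_polyXr !polyC0 !polyC1 !(mulr0, mul0r, mulr1, mul1r, addr0, add0r) => H00 H01 H10.
have b_0 : b = 0 /\ d = 0.
  have g00 : rho 0 0 f2 = 0.
    apply: (small_mul _ (d%:P - b%:P * (K n \Po L))); first by rewrite -H00 addrK.
    apply: leq_trans (size_polyD _ _) _; rewrite size_polyN geq_max.
    rewrite (leq_trans (size_polyC_leq1 _)) ?(ltnW (ltnW n3)) //=.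
    by rewrite mul_polyC (leq_trans (size_scale_leq _ _)) ?sK.
  rewrite g00 mul0r add0r in H00.
  have b_0 : b = 0.
    apply/eqP/negPn/negP => b0; have := congr1 (fun p : {poly k} => size p) H00.
    rewrite /= mul_polyC size_scale // sK => E'.
    by have := size_polyC_leq1 d; rewrite -E'; lia.
  by split=> //; apply/eqP; rewrite -polyC_eq0 -H00 b_0 mul0r.
move: b_0 H00 H01 H10 E => [-> ->] _; rewrite !rmorph0 !mul0r !addr0 => H01 H10 E.
have H10' : rho 1 0 f2 * (K n.+1 \Po L) = c%:P * K n - a%:P * (K n \Po L).
  by rewrite -H10 addrK.
have Knu : a%:P * (K n \Po L) = c%:P * K n.
  have g10 : rho 1 0 f2 = 0.
    apply: small_mul H10' _; apply: leq_trans (size_polyD _ _) _; rewrite size_polyN geq_max.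
    by rewrite !mul_polyC !(leq_trans (size_scale_leq _ _)) ?sK ?size_continuant.
  by apply/eqP; rewrite -subr_eq0 -oppr_eq0 opprB -H10' g10 mul0r.
have K1 : K n.+1 != 0 by rewrite continuant_eq0.
have r0 : rho 0 1 f2 != 0.
  apply/eqP => r0; move/eqP: H01; rewrite r0 mul0r eq_sym mulf_eq0 polyC_eq0 (negPf c0).
  by rewrite (negPf K1).
have [e Ee] : exists e, rho 0 1 f2 = e%:P.
  exists (rho 0 1 f2)`_0; apply: size1_polyC.
  have := congr1 (fun p : {poly k} => size p) H01.
  rewrite /= mul_polyC size_scale // size_continuant size_mul // ?sK -?size_poly_eq0 ?sK //.
  by move: (size _) => sz; lia.
have e0 : e != 0 by move: r0; rewrite Ee polyC_eq0.
rewrite Ee in H01.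
have n_eq : n = (n - 2).+2 by lia.
have Enu : K n \Po L = (c / a) *: K n.
  apply: (mulfI (x := a%:P)); first by rewrite polyC_eq0.
  by rewrite Knu !mul_polyC scalerA mulrC divfK.
have Emu : K n.+1 \Po L = (c / e) *: K n.+1.
  apply: (mulfI (x := e%:P)); first by rewrite polyC_eq0.
  by rewrite H01 !mul_polyC scalerA mulrC divfK.
have nu0 : c / a != 0 by rewrite mulf_neq0 ?invr_eq0.
rewrite n_eq in Enu Emu.
have [h0 g2 Eme] := continuant_affine erefl g0 nu0 Emu Enu.
have Eae : e = a * g.
  have : a = e * g.
    apply: (mulfI (x := c / a / e)); first by rewrite !mulf_neq0 ?invr_eq0.
    transitivity (c / e); first by field; rewrite a0 e0.
    by rewrite Eme; field; rewrite a0 e0.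
  by move=> ->; rewrite -mulrA -expr2 g2 mulr1.
exists a, g; split=> //; rewrite h0 rmorph0 !addr0 -Eae; congr (_, _, _).
(* The specializations only determine the constants; [f2] itself comes from [E] by cancelling K
   n.+1. *)
have HL (u : {poly k}) : u^f.[cst g * x3 + cst h] = (u \Po L)^f.[x3].
  rewrite map_comp_poly horner_comp; congr (_.[_]).
  by rewrite rmorphD /= map_polyZ map_polyX map_polyC !hornerE.
have KL : (K n.+1)^f.[cst g * x3 + cst h] = cst (c / e) * (K n.+1)^f.[x3].
  by rewrite HL n_eq Emu -n_eq map_polyZ hornerZ.
have KLn : cst a * (K n)^f.[cst g * x3 + cst h] = cst c * (K n)^f.[x3].
  rewrite HL n_eq Enu -n_eq map_polyZ hornerZ mulrA -rmorphM; congr (cst _ * _).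
  by rewrite mulrC divfK.
have Kx : (K n.+1)^f.[x3] != 0.
  apply/eqP => /(congr1 (rho 0 0)); rewrite rhoh rho3 comp_polyXr rmorph0 => /eqP.
  by rewrite (negPf K1).
apply: (mulIf Kx); apply: (mulfI (x := cst (c / e))).
  by rewrite cst_eq0 mulf_neq0 ?invr_eq0.
transitivity (f2 * (K n.+1)^f.[cst g * x3 + cst h]); first by rewrite KL; ring.
have -> : f2 * (K n.+1)^f.[cst g * x3 + cst h] = cst c * (x2 * (K n.+1)^f.[x3]).
  apply: (addIr (x1 * (cst a * (K n)^f.[cst g * x3 + cst h]))).
  rewrite {2}KLn; transitivity (f2 * (K n.+1)^f.[cst g * x3 + cst h] +
    cst a * x1 * (K n)^f.[cst g * x3 + cst h]); first by ring.
  by rewrite E; ring.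
have Ec : cst c = cst (c / e) * cst e by rewrite -rmorphM divfK.
by rewrite Ec; ring.
Qed.

End Rigid.
End Rigidity.

(** * The explicit form of j *)

Section Conclusion.
Variables (k : fieldType) (M : pol3 k).
Hypothesis char0 : [pchar k] =i pred0.
Local Notation R := (pol M).
Local Notation x1 := (px1 M).
Local Notation x2 := (px2 M).
Local Notation x3 := (px3 M).
Local Notation cst := (pcst M).
Local Notation mapg := (mapg M).
Local Notation mapG := (mapG M).
Implicit Types (P Q : R) (A B : R * R * R).
Variable n : nat.
Hypothesis n3 : (2 < n)%N.
Local Notation Sop := (@Sop k M n).
Local Notation Top := (@Top k M n).

(** Lets iterates of [Sop] and [Top] be treated as substitutions without writing out their maps. *)
Definition is_sub (f : R -> R) := exists A, forall P, f P = sub A P.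

Lemma is_sub_sub A : is_sub (sub A). Proof. by exists A. Qed.

Lemma is_sub_comp f g : is_sub f -> is_sub g -> is_sub (fun P => f (g P)).
Proof. by move=> [A EA] [B EB]; exists (pcomp B A) => P; rewrite EA EB sub_comp. Qed.

Lemma is_sub_iter m f : is_sub f -> is_sub (iter m f).
Proof.
move=> fs; elim: m => [|m IH]; first by exists (pid M) => P; rewrite sub_id.
exact: is_sub_comp fs IH.
Qed.

Lemma is_sub_S : is_sub Sop.
Proof. by apply: is_sub_comp (is_sub_sub _) _; apply: is_sub_iter; apply: is_sub_sub. Qed.

Lemma is_sub_T : is_sub Top.
Proof.
by apply: (is_sub_comp (g := sub (maphV M))) (is_sub_sub _); apply: is_sub_iter; apply: is_sub_sub.
Qed.

Lemma iter_cancel m (f g : R -> R) : cancel f g -> cancel (iter m f) (iter m g).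
Proof. by move=> fg P; elim: m => // m IH; rewrite iterSr iterS fg IH. Qed.

Lemma is_sub_inv f g : is_sub f -> is_sub g -> cancel f g -> cancel g f ->
  exists A B, [/\ is_inv A B, forall P, f P = sub A P & forall P, g P = sub B P].
Proof.
move=> [A EA] [B EB] fg gf; exists A, B; split=> //.
have e1 P : sub B (sub A P) = P by rewrite -EA -EB.
have e2 P : sub A (sub B P) = P by rewrite -EB -EA.
split; rewrite /pcomp /pid.
  by rewrite -[in A.1.1](sub_X1 A) -[in A.1.2](sub_X2 A) -[in A.2](sub_X3 A) !e1.
by rewrite -[in B.1.1](sub_X1 B) -[in B.1.2](sub_X2 B) -[in B.2](sub_X3 B) !e2.
Qed.

Lemma coprimary_x2_x3 : coprimary x2 x3.
Proof.
exists (pid M), (pid M); split; first by split; rewrite pcomp_id.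
exists 0, 1, 0, 0, 0, 0, 1, 0; split; rewrite ?xpair_eqE ?oner_eq0 ?andbF //.
- by rewrite sub_id /affine !rmorph0 rmorph1 !mul0r mul1r !addr0 add0r.
- by rewrite sub_id /affine !rmorph0 rmorph1 !mul0r mul1r !addr0 add0r.
Qed.

Lemma coprimary_G m P Q : coprimary P Q ->
  coprimary (iter m (sub mapG) P) (iter m (sub mapG) Q).
Proof. by move=> H; elim: m => //= m; apply: coprimary_sub (is_invC (inv_g M)). Qed.

Lemma coprimary_T m P Q : coprimary P Q -> coprimary (iter m Top P) (iter m Top Q).
Proof.
move=> H; elim: m => //= m IH; apply: coprimary_G.
exact: coprimary_sub (is_invC (inv_h M)) IH.
Qed.

Lemma coprimary_x3_Top : coprimary x3 (Top x3).
Proof.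
have Gx3 : iter n (sub mapG) x3 = x3 by elim: (n) => //= m ->; rewrite subX.
rewrite /Top sub_X3 -{1}Gx3; apply: coprimary_G.
exact: coprimary_sym coprimary_x2_x3.
Qed.

Definition diag (a g : k) : R * R * R := (cst a * x1, cst (a * g) * x2, cst g * x3).

Lemma diagK (a g : k) : a ^+ 2 = 1 -> g ^+ 2 = 1 -> involutive (sub (diag a g)).
Proof.
move=> a2 g2 P; rewrite sub_comp -[RHS]sub_id; congr (sub _ P).
rewrite /pcomp /diag /pid /= !rmorphM !subX /= -!rmorphM !mulrA -!rmorphM /=.
by rewrite -expr2 a2 -expr2 exprMn a2 g2 mul1r -expr2 g2 !rmorph1 !mul1r.
Qed.

(** Rigidity at time t uses times t-1, t and t+1, so the four times 0 to 3 give it at 1 and 2. As f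
    carries x3 to x1, the free first entry at time 2 equals the last entry at time 1, which is a
    sign. *)
Theorem displacement_form (C kk : nat) (j j' : R * R * R) :
  (5 * (2 * C + 3) <= kk)%N -> is_inv j j' ->
  reach C x3 (sub j' x3) -> reach C (iter kk Top x3) (sub j' (iter kk Top x3)) ->
  exists (c d : 'I_kk.+1) (s t : bool), forall P,
    sub j P = iter c Top (sub (diag ((-1) ^+ s) ((-1) ^+ t)) (iter d Sop P)).
Proof.
move=> kkC jj' r0 r1.
pose q l := sub j' (iter l Top x3).
have q_step l : coprimary (q l) (q l.+1).
  rewrite /q iterSr; apply: coprimary_sub (is_invC jj') _.
  exact: coprimary_T coprimary_x3_Top.
have [i [l [ik lk ax]]] := axial_run char0 n3 q_step r0 r1 kkC.
pose Phi t P := iter (i + t) Sop (sub j' (iter (l + t) Top P)).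
pose Psi t P := iter (l + t) Sop (sub j (iter (i + t) Top P)).
have SK : cancel Sop Top by move=> P; apply: TopK.
have TK : cancel Top Sop by move=> P; apply: SopK.
have PhiK t : cancel (Phi t) (Psi t).
  by move=> P; rewrite /Phi /Psi (iter_cancel _ SK) (sub_inv _ jj') (iter_cancel _ TK).
have PsiK t : cancel (Psi t) (Phi t).
  by move=> P; rewrite /Phi /Psi (iter_cancel _ SK) (sub_inv _ (is_invC jj')) (iter_cancel _ TK).
have Phi_sub t : is_sub (Phi t).
  apply: is_sub_comp (is_sub_iter _ is_sub_S) _; apply: is_sub_comp (is_sub_sub _) _.
  exact: is_sub_iter is_sub_T.
have Psi_sub t : is_sub (Psi t).
  apply: is_sub_comp (is_sub_iter _ is_sub_S) _; apply: is_sub_comp (is_sub_sub _) _.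
  exact: is_sub_iter is_sub_T.
have PhiS t P : Phi t.+1 P = Sop (Phi t (Top P)) by rewrite /Phi !addnS -iterSr.
have [S ES] := is_sub_S; have [T ET] := is_sub_T.
have Tx1 : Top x1 = x3 by rewrite -(Sop_x3 M n) SK.
have Sx3 : Sop x3 = x1 := Sop_x3 M n.
(* One relation on x3 at time t is also a relation on x3 o f = x1 at time t+1 and on x3 o f^-1 at
   time t-1, with the same [u]. *)
have rel t : (t < 4)%N -> exists u,
    [/\ Phi t x3 = (map_poly cst u).[x3], Phi t.+1 x1 = (map_poly cst u).[x1]
      & forall r, t = r.+1 -> Phi r (Top x3) = (map_poly cst u).[Top x3]].
  move=> t4; have [u Eu] := axial_horner (ax t t4); exists u.
  have E3 : Phi t x3 = (map_poly cst u).[x3] by rewrite -[LHS]sub_id Eu.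
  split=> //; first by rewrite PhiS Tx1 E3 ES sub_horner -ES Sx3.
  by move=> r Er; rewrite -[LHS]SK -PhiS -Er E3 !ET sub_horner -!ET.
have [u0 [_ E01 _]] := rel 0%N isT; have [u1 [E13 E11 _]] := rel 1%N isT.
have [u2 [E23 _ E2T]] := rel 2%N isT; have [u3 [_ _ E3T]] := rel 3%N isT.
have rig t v0 v1 v2 : Phi t x1 = (map_poly cst v0).[x1] -> Phi t x3 = (map_poly cst v1).[x3] ->
    Phi t (Top x3) = (map_poly cst v2).[Top x3] ->
    exists a g, [/\ g ^+ 2 = 1, a != 0 & forall P, Phi t P = sub (diag a g) P].
  move=> F1 F3 FT; have [A [B [AB EA _]]] := is_sub_inv (Phi_sub t) (Psi_sub t) (PhiK t) (PsiK t).
  have [|||a [g [g2 a0 EAd]]] := @rigid _ _ n n3 A B v0 v1 v2 AB.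
  - by rewrite -sub_X1 -EA.
  - by rewrite -sub_X3 -EA.
  - by rewrite -EA.
  by exists a, g; split=> // P; rewrite EA EAd.
have [a1 [g1 [g12 _ F1]]] := rig 1%N _ _ _ E01 E13 (E2T _ erefl).
have [a [g [g2 _ F2]]] := rig 2%N _ _ _ E11 E23 (E3T _ erefl).
have ag : a = g1.
  have : cst a * x1 = cst g1 * x1.
    have <- : Phi 2 x1 = cst a * x1 by rewrite F2 sub_X1.
    by rewrite PhiS Tx1 F1 sub_X3 /= ES rmorphM sub_cst -ES Sx3.
  by move/(mulIf (px1_neq0 M))/fmorph_inj.
rewrite {}ag in F2.
have l2 : (l + 2 < kk.+1)%N by lia.
have i2 : (i + 2 < kk.+1)%N by lia.
have sign (x : k) : x ^+ 2 = 1 -> exists s : bool, x = (-1) ^+ s.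
  by move=> /eqP; rewrite sqrf_eq1 => /orP[] /eqP->; [exists false | exists true].
have [s Es] := sign _ g12; have [t Et] := sign _ g2.
exists (Ordinal l2), (Ordinal i2), s, t => P; rewrite -Es -Et /=.
set Q := sub (diag _ _) _.
have EQ : iter (i + 2) Sop P = Phi 2 Q by rewrite F2 /Q diagK.
have := congr1 (Psi 2) EQ; rewrite PhiK {1}/Psi (iter_cancel _ SK) => <-.
by rewrite (iter_cancel _ SK).
Qed.

End Conclusion.

(** * Inverses of affine and elementary maps *)

Section AffineMaps.
Variables (k : fieldType) (M : pol3 k).
Local Notation R := (pol M).
Local Notation x1 := (px1 M).
Local Notation x2 := (px2 M).
Local Notation x3 := (px3 M).
Local Notation cst := (pcst M).

Definition affine_map (A : 'M[k]_3) (c : 'I_3 -> k) : R * R * R :=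
  let f (i : 'I_3) := \sum_(j < 3) cst (A i j) * nth 0 [:: x1; x2; x3] j + cst (c i) in
  (f 0, f 1, f 2).

Lemma affine_map_comp A B c d : pcomp (affine_map A c) (affine_map B d) =
  affine_map (A *m B) (fun i => \sum_j A i j * d j + c i).
Proof.
have f i : sub (affine_map B d) (\sum_(j < 3) cst (A i j) * nth 0 [:: x1; x2; x3] j + cst (c i)) =
   \sum_(j < 3) cst ((A *m B) i j) * nth 0 [:: x1; x2; x3] j + cst (\sum_j A i j * d j + c i).
  have fj (j : 'I_3) : sub (affine_map B d) (nth 0 [:: x1; x2; x3] j) =
      \sum_(l < 3) cst (B j l) * nth 0 [:: x1; x2; x3] l + cst (d j).
    have [->|[->|->]] : j = 0 \/ (j = 1 \/ j = 2).
    - case: j => [[|[|[|]]]] // lt; [left | right; left | right; right]; exact: val_inj.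
    - by rewrite sub_X1.
    - by rewrite sub_X2.
    - by rewrite sub_X3.
  rewrite rmorphD rmorph_sum sub_cst rmorphD addrA; congr (_ + _).
  under eq_bigr => j _ do rewrite rmorphM sub_cst fj mulrDr mulr_sumr.
  rewrite big_split /= exchange_big /=; congr (_ + _).
    apply: eq_bigr => l _; rewrite mxE rmorph_sum mulr_suml.
    by apply: eq_bigr => j _; rewrite rmorphM mulrA.
  by rewrite rmorph_sum; apply: eq_bigr => j _; rewrite rmorphM.
by rewrite /pcomp /= !f.
Qed.

Lemma affine_map1 c : (forall i, c i = 0) -> affine_map 1%:M c = pid M.
Proof.
move=> c0; rewrite /affine_map /pid /= !c0 !rmorph0 !addr0 !big_ord_recl !big_ord0 /= !mxE /=.
by rewrite !rmorph1 !rmorph0 !mul0r !mul1r !addr0 !add0r.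
Qed.

Lemma affine_map_inv A c : A \in unitmx -> exists B, is_inv (affine_map A c) B.
Proof.
move=> uA; exists (affine_map (invmx A) (fun i => - \sum_j invmx A i j * c j)).
have E d i : \sum_j A i j * - (\sum_l invmx A j l * d l) = - d i :> k.
  have := congr1 (fun v : 'cV_3 => v i 0) (mulKVmx uA (\col_i d i)).
  rewrite !mxE => <-; rewrite -sumrN; apply: eq_bigr => j _; rewrite mulrN mxE.
  by congr (- (_ * _)); apply: eq_bigr => l _; rewrite mxE.
split; rewrite affine_map_comp ?mulmxV ?mulVmx //; apply: affine_map1 => i.
  by rewrite E addNr.
by rewrite addrN.
Qed.

(** The hypothesis expresses that [E] involves x2 and x3 only. *)
Lemma elementary_inv (E : R) : (forall B, B.1.2 = x2 -> B.2 = x3 -> sub B E = E) ->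
  is_inv (x1 + E, x2, x3) (x1 - E, x2, x3).
Proof.
move=> HE; split; rewrite /pcomp /= !(rmorphD, rmorphN) !subX /= !HE //.
  by rewrite subrK.
by rewrite addrK.
Qed.

End AffineMaps.

(** * Identification with the maps of the statement *)

Section Bridge.
Variable k : fieldType.
Local Notation M := (R3_pol3 k).
Implicit Types (F A B : Map k) (P Q p q : R3 k) (u v : seq (R3 k)).

Lemma ev_sub B P : ev B P = sub (M := M) B P.
Proof. by []. Qed.

Lemma inv_pair_is_inv A B : inv_pair A B -> is_inv (M := M) A B.
Proof. by []. Qed.

Lemma mcompE A B : mcomp A B = pcomp (M := M) A B.
Proof. by []. Qed.

Lemma ev_comp A B P : ev B (ev A P) = ev (mcomp A B) P.
Proof. by rewrite !ev_sub mcompE sub_comp. Qed.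

Lemma affmapE (A : 'M[k]_3) c : affmap A c = affine_map M A c.
Proof. by []. Qed.

Lemma elemE (P : {poly {poly k}}) : elem P = (px1 M + embed23 P, px2 M, px3 M) :> Map k.
Proof. by []. Qed.

Lemma sub_embed23 (P : {poly {poly k}}) (B : M * M * M) :
  B.1.2 = px2 M -> B.2 = px3 M -> sub B (embed23 P) = embed23 P :> M.
Proof.
move=> B2 B3.
suff [E EP] : exists u : M, u = embed23 P /\ sub B u = u by case: EP => ->.
rewrite /embed23; elim/poly_ind: P => [|P c [u [Eu Su]]].
  by exists 0; rewrite map_poly0 (rmorph0 (sub B)).
have [v [Ev Sv]] : exists v : M, v = (map_poly polyC c)%:P /\ sub B v = v.
  elim/poly_ind: c => [|Q d [v [Ev Sv]]]; first by exists 0; rewrite map_poly0 (rmorph0 (sub B)).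
  exists (v * px2 M + pcst M d); split.
    by rewrite Ev rmorphD rmorphM /= map_polyX map_polyC polyCD polyCM.
  by rewrite (rmorphD (sub B)) (rmorphM (sub B)) Sv sub_X2 B2 sub_cst.
exists (u * px3 M + v); split; last by rewrite (rmorphD (sub B)) (rmorphM (sub B)) Su Sv sub_X3 B3.
by rewrite Eu Ev rmorphD rmorphM /= map_polyX map_polyC.
Qed.

End Bridge.

(** * Affine combinations of the components of a vertex *)

Section Combinations.
Variables (k : fieldType) (M : pol3 k).
Local Notation cst := (pcst M).

(** Affine changes of the tuple preserve this set of polynomials, so it is attached to the vertex
    and not to a representative. *)
Definition combination m (u : nat -> M) (p : M) := exists (a : 'I_m -> k) (c : k),
  (exists i, a i != 0) /\ p = \sum_(i < m) cst (a i) * u i + cst c.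

Lemma combination_nth m (u : nat -> M) : (0 < m)%N -> combination m u (u 0).
Proof.
case: m => // m _; exists (fun i => (i == 0)%:R), 0; split.
  by exists 0; rewrite eqxx oner_neq0.
rewrite rmorph0 addr0 (bigD1 0) //= rmorph1 mul1r big1 ?addr0 // => i /negPf->.
by rewrite rmorph0 mul0r.
Qed.

Lemma identity_combination m (u : nat -> M) (i : 'I_m) :
  u i = \sum_(j < m) cst ((1%:M : 'M[k]_m) i j) * u j + cst 0.
Proof.
rewrite rmorph0 addr0 (bigD1 i) //= mxE eqxx rmorph1 mul1r big1 ?addr0 //.
by move=> j ji; rewrite mxE eq_sym (negPf ji) rmorph0 mul0r.
Qed.

Lemma combination_affine m (A : 'M[k]_m) c (u v : nat -> M) p : A \in unitmx ->
  (forall i : 'I_m, v i = \sum_(j < m) cst (A i j) * u j + cst (c i)) ->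
  combination m v p -> combination m u p.
Proof.
move=> uA Ev [a [d [[i0 ai0] ->]]]; pose r : 'rV_m := \row_i a i.
exists (fun j => (r *m A) 0 j), (\sum_i a i * c i + d); split.
  apply/existsP; apply: contraNT ai0; rewrite negb_exists => /forallP r0.
  have rA0 : r *m A = 0 by apply/rowP=> j; rewrite [RHS]mxE; apply/eqP/negPn; apply: r0.
  have : r = 0 by rewrite -[r](mulmxK uA) rA0 mul0mx.
  by move/matrixP/(_ 0 i0); rewrite !mxE => ->.
rewrite rmorphD addrA; congr (_ + _).
under eq_bigr => i _ do rewrite Ev mulrDr mulr_sumr.
rewrite big_split /= exchange_big /=; congr (_ + _).
  apply: eq_bigr => j _; rewrite mxE rmorph_sum mulr_suml.
  by apply: eq_bigr => i _; rewrite mxE rmorphM mulrA.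
by rewrite rmorph_sum; apply: eq_bigr => i _; rewrite rmorphM.
Qed.

Lemma combination_components (F : M * M * M) i p : (1 <= i <= 3)%N ->
  combination i (nth 0 [:: F.1.1; F.1.2; F.2]) p ->
  exists a b c d, (a, b, c) != (0, 0, 0) /\ p = sub F (affine M a b c d).
Proof.
have E a b c d : sub F (affine M a b c d) =
    cst a * F.1.1 + cst b * F.1.2 + cst c * F.2 + cst d.
  by rewrite /affine !rmorphD !rmorphM !subX.
case: i => [|[|[|[|i]]]] // _ [a [d [[i0 ai0] ->]]].
- exists (a 0), 0, 0, d; rewrite E !xpair_eqE; split.
    by move: ai0; rewrite (ord1 i0) => /negPf->.
  by rewrite big_ord1 /= !rmorph0 !mul0r !addr0.
- exists (a 0), (a 1), 0, d; rewrite E !xpair_eqE; split.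
    rewrite eqxx andbT; apply: contraNN ai0 => /andP[a0 a1].
    have [->//|->//] : i0 = 0 \/ i0 = 1.
    by case: i0 => [[|[|]]] // lt; [left|right]; apply: val_inj.
  rewrite !big_ord_recl big_ord0 /= !rmorph0 !mul0r !addr0; congr (_ + _ * _ + _).
  by congr (cst (a _)); apply: val_inj.
- exists (a 0), (a 1), (a 2), d; rewrite E !xpair_eqE; split.
    apply: contraNN ai0 => /andP[/andP[a0 a1] a2].
    have [->//|[->//|->//]] : i0 = 0 \/ (i0 = 1 \/ i0 = 2).
    case: i0 => [[|[|[|]]]] // lt; [left|right;left|right;right]; exact: val_inj.
  rewrite !big_ord_recl big_ord0 /= addr0 !addrA.
  do 2!congr (_ + _); [congr (_ + _ * _)|];
    by congr (cst (a _) * _) || congr (cst (a _)); apply: val_inj.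
Qed.

Lemma combination_coprimary (F F' : M * M * M) i j p q : is_inv F F' ->
  (1 <= i <= 3)%N -> (1 <= j <= 3)%N ->
  combination i (nth 0 [:: F.1.1; F.1.2; F.2]) p ->
  combination j (nth 0 [:: F.1.1; F.1.2; F.2]) q -> coprimary p q.
Proof.
move=> FF' hi hj /(combination_components hi)[a [b [c [d [abc Ep]]]]].
move=> /(combination_components hj)[a' [b' [c' [d' [abc' Eq]]]]].
by exists F, F'; split=> //; exists a, b, c, d, a', b', c', d'.
Qed.

End Combinations.

(** * Edge paths as chains of components *)

Section Paths.
Variable k : fieldType.
Local Notation M := (R3_pol3 k).
Implicit Types (F : Map k) (u v : seq (R3 k)) (p q : R3 k).

Lemma tame_inv F : tame F -> exists F', is_inv (M := M) F F'.
Proof.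
elim=> [|A c {}F uA _ [F' FF']|P {}F _ [F' FF']].
- by exists (pid M); split; rewrite pcomp_id.
- have [B AB] := affine_map_inv M c uA; exists (@pcomp k M F' B).
  rewrite mcompE affmapE.
  exact: (@is_inv_comp k M _ _ _ _ AB FF').
- have EE := elementary_inv (@sub_embed23 k P).
  exists (@pcomp k M F' (px1 M - embed23 P, px2 M, px3 M)).
  rewrite mcompE elemE.
  exact: (@is_inv_comp k M _ _ _ _ EE FF').
Qed.

Definition comb u p := combination (M := M) (size u) (nth 0 u) p.

Lemma comb_head u : (0 < size u)%N -> comb u (nth 0 u 0).
Proof. exact: (combination_nth (M := M)). Qed.

Lemma comb_aff_eq u v p : aff_eq u v -> comb v p -> comb u p.
Proof.
case=> sz [A [c [uA E]]]; rewrite /comb sz.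
exact: (combination_affine (M := M) uA E).
Qed.

Lemma comb_take F i p : (1 <= i <= 3)%N -> comb (take i (comps F)) p ->
  combination (M := M) i (nth 0 [:: F.1.1; F.1.2; F.2]) p.
Proof.
rewrite /comb /comps; case: i => [|[|[|[|i]]]] // _ [a [c [a0 ->]]];
  exists a, c; split=> //; congr (_ + _); apply: eq_bigr => i _.
- by rewrite (ord1 i).
- by case: i => [[|[|]]].
Qed.

Definition vertexlike u := exists F F' i, [/\ is_inv (M := M) F F', (1 <= i <= 3)%N
  & aff_eq (take i (comps F)) u].

Lemma vertexlike_coprimary u p q : vertexlike u -> comb u p -> comb u q ->
  coprimary (M := M) p q.
Proof.
move=> [F [F' [i [FF' hi E]]]] /(comb_aff_eq E)/(comb_take hi) cp.
by move=> /(comb_aff_eq E)/(comb_take hi) cq; exact: (combination_coprimary FF' hi hi cp cq).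
Qed.

Lemma adj_coprimary u v p q : adj u v -> comb u p -> comb v q ->
  coprimary (M := M) p q.
Proof.
move=> [F [tF [i [j [/and3P[hi hj _] [E E']]]]]].
move=> /(comb_aff_eq E)/(comb_take hi) cp /(comb_aff_eq E')/(comb_take hj) cq.
have [F' FF'] := tame_inv tF.
exact: (combination_coprimary FF' hi hj cp cq).
Qed.

Lemma adj_vertexlike u v : adj u v -> vertexlike v.
Proof.
move=> [F [tF [i [j [/and3P[hi hj _] [E E']]]]]]; have [F' FF'] := tame_inv tF.
by exists F, F', j.
Qed.

Lemma vertexlike_size u : vertexlike u -> (0 < size u)%N.
Proof.
by move=> [F [F' [i [_ hi [-> _]]]]]; case: i hi => [|[|[|[|]]]].
Qed.

(** Each edge gives one link between chosen components; the additional link joins the component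
    chosen in the last vertex to [q]. *)
Lemma path_reach m (w : nat -> seq (R3 k)) p q :
  vertexlike (w 0%N) -> comb (w 0%N) p -> comb (w m) q ->
  (forall i, (i < m)%N -> adj (w i) (w i.+1)) -> reach (M := M) m.+1 p q.
Proof.
elim: m w p => [|m IH] w p vw cp cq adjw.
  by exists q; split=> //; exact: (vertexlike_coprimary vw cp cq).
have v1 := adj_vertexlike (adjw 0%N isT).
have c1 := comb_head (vertexlike_size v1).
exists (nth 0 (w 1%N) 0); split; first exact: (adj_coprimary (adjw 0%N isT) cp c1).
by apply: (IH (fun i => w i.+1)) => // i lt; apply: adjw.
Qed.

Lemma reach_pad (N : pol3 k) m m' (p q : N) : coprimary p p -> (m <= m')%N ->
  reach m p q -> reach m' p q.
Proof.
move=> pp /subnK <- r; elim: (m' - m)%N => // d IH.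
by rewrite addSn; exists p.
Qed.

Lemma comb_seq1 p : comb [:: p] p.
Proof. exact: (comb_head (u := [:: p])). Qed.

Lemma aff_eq_refl u : aff_eq u u.
Proof.
split=> //; exists 1%:M, (fun=> 0); split; first exact: unitmx1.
exact: (identity_combination (M := M)).
Qed.

Lemma vertexlike_seq1 F F' : is_inv (M := M) F F' -> vertexlike [:: F.1.1].
Proof. by move=> FF'; exists F, F', 1%N; split=> //; apply: aff_eq_refl. Qed.

Lemma dle_reach C F F' q : is_inv (M := M) F F' -> dle C [:: F.1.1] [:: q] ->
  reach (M := M) C.+1 F.1.1 q.
Proof.
move=> FF' [m [w [mC [w0 [wm adjw]]]]].
have vw : vertexlike (w 0%N) by rewrite w0; apply: vertexlike_seq1 FF'.
have cp : comb (w 0%N) F.1.1 by rewrite w0; apply: comb_seq1.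
have cq : comb (w m) q by apply: comb_aff_eq wm (comb_seq1 q).
apply: (@reach_pad M m.+1) => //; last exact: (path_reach vw cp cq adjw).
exact: (vertexlike_coprimary vw cp cp).
Qed.

End Paths.

(** * Powers of f, the base vertex and the WPD property *)

Section Orbit.
Variables (k : fieldType) (n : nat).
Local Notation M := (R3_pol3 k).

Lemma ev_mpow (F : Map k) m P : ev (mpow F m) P = iter m (ev F) P.
Proof.
elim: m P => [|m IH] P; first exact: (sub_id (M := M)).
by rewrite iterSr -IH ev_comp.
Qed.

Lemma ev_tfinv P : ev (tfinv k n) P = Top (M := M) n P.
Proof.
by rewrite /tfinv -ev_comp ev_mpow.
Qed.

Lemma ev_mpow_tfinv m P : ev (mpow (tfinv k n) m) P = iter m (Top (M := M) n) P.
Proof. by rewrite ev_mpow; apply: eq_iter => Q; apply: ev_tfinv. Qed.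

Lemma affine_map_swap (N : pol3 k) : (affine_map N (tperm_mx 0 2) (fun=> 0)).1.1 = px3 N.
Proof.
rewrite /= rmorph0 addr0 (bigD1 2) //= big1 ?addr0 => [|j j2].
  by rewrite !mxE tpermL eqxx rmorph1 mul1r.
by rewrite !mxE tpermL eq_sym (negPf j2) rmorph0 mul0r.
Qed.

Lemma is_vertex_X3 : is_vertex [:: X3 k].
Proof.
split=> //; exists (mcomp (affmap (tperm_mx 0 2) (fun=> 0)) (id3 k)); split.
  by apply: tame_aff (tame_id k); apply: unitmx_perm.
rewrite -[RHS]/[:: (mcomp (affmap (tperm_mx 0 2) (fun=> 0)) (id3 k)).1.1]; congr [:: _].
rewrite mcompE affmapE -[RHS]/(sub (pid M) (affine_map M _ _).1.1) sub_id.
exact: esym (affine_map_swap M).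
Qed.

End Orbit.

Theorem theoremD (k : fieldType) (hk : [pchar k] =i pred0) (n : nat)
  (hn : (12 <= n)%N) (hev : ~~ odd n) :
  WPD (@tfinv k n).
Proof.
exists [:: X3 k]; split; first exact: is_vertex_X3.
(* The length that [diagonal_run] demands, with [C.+1] because a path of C edges becomes a chain of
   C + 1 links. *)
move=> C _; exists (5 * (2 * C.+1 + 3))%N => kk large.
pose M := R3_pol3 k; have n3 : (2 < n)%N := leq_trans (isT : 3 <= 12)%N hn.
(* For fixed [kk], two exponents up to [kk] and two signs determine j, so the list does not depend
   on j. *)
pose entry (x : 'I_kk.+1 * 'I_kk.+1 * bool * bool) : Map k :=
  let f := fun P : M => iter x.1.1.1 (Top n)
    (sub (diag M ((-1) ^+ x.1.2) ((-1) ^+ x.2)) (iter x.1.1.2 (Sop n) P)) in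
  (f (px1 M), f (px2 M), f (px3 M)).
exists [seq entry x | x <- enum {: 'I_kk.+1 * 'I_kk.+1 * bool * bool}] => j j' _ jj' d0 d1.
have jj : is_inv (M := M) j j' := inv_pair_is_inv jj'.
have r0 : reach C.+1 (px3 M) (sub (M := M) j' (px3 M)).
  exact: (dle_reach (k := k) (F := maphV M) (is_invC (inv_h M)) d0).
have [A [B [AB EA _]]] := is_sub_inv (is_sub_iter kk (is_sub_T M n))
  (is_sub_iter kk (is_sub_S M n)) (iter_cancel kk (@SopK k M n)) (iter_cancel kk (@TopK k M n)).
have d2 : dle C [:: iter kk (Top n) (px3 M) : R3 k]
    [:: sub (M := M) j' (iter kk (Top n) (px3 M)) : R3 k].
  by move: d1; rewrite /act_by_inv /= -ev_comp !ev_mpow_tfinv.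
have r1 : reach C.+1 (iter kk (Top n) (px3 M)) (sub (M := M) j' (iter kk (Top n) (px3 M))).
  (* [dle_reach] wants the base point as the first component of an invertible map; h^-1 has first
     component x3. *)
  have E : (pcomp (maphV M) A).1.1 = iter kk (Top n) (px3 M) by rewrite EA.
  rewrite -{1}E; apply: (dle_reach (k := k)).
    exact: is_inv_comp (is_invC (inv_h M)) AB.
  rewrite E; exact: d2.
have [c [d [s [t E]]]] := displacement_form hk n3 large jj r0 r1.
have -> : j = entry (c, d, s, t).
  rewrite /entry /= -!E !sub_X1 sub_X2 sub_X3.
  by case: j {jj jj' E} => [[? ?] ?].
by apply: map_f; rewrite mem_enum.
Qed.
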